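(* For every $\phi_0 \in \mathfrak{K}(a,b,\kappa_1,\kappa_2)$, we have $$\mathfrak{R}_n(\phi_0) \geq \frac{\kappa_1^2}{4096\,c_2}\left(\frac{\sqrt{c_1}}{\kappa_2}\right)^{8/5}(b-a)\left(\frac{\sigma^2}{n}\right)^{4/5}$$ provided $n^2 \geq (2c_2)^{5/2}\kappa_2/(\sigma\sqrt{c_1})$.
   Context: Let $\mathcal{C}$ denote the set of all real-valued convex functions on $[0,1]$. Let $n \ge 2$ and let $x_1 < x_2 < \dots < x_n$ be fixed design points in $[0,1]$ satisfying $c_1 \le n(x_i - x_{i-1}) \le c_2$ for $i = 2, \dots, n$, where $c_1, c_2$ are positive constants. For $\phi\in\mathcal{C}$, the observations under $\phi$ are $Y_i = \phi(x_i)+\xi_i$, $i=1,\dots,n$, where $\xi_1,\dots,\xi_n$ are independent normal random variables with mean zero and variance $\sigma^2>0$; $\mathbb{E}_\phi$ denotes expectation when the true function is $\phi$. For a subinterval $[a,b]$ of $[0,1]$ and positive real numbers $\kappa_1<\kappa_2$, $\mathfrak{K}(a,b,\kappa_1,\kappa_2)$ is the class of all convex functions $\phi$ on $[0,1]$ which are twice differentiable on $[a,b]$ and satisfy $\kappa_1\le\phi''(x)\le\kappa_2$ for all $x\in[a,b]$. For real functions $\phi,\psi$ on $[0,1]$, $\ell^2(\phi,\psi) := \frac1n\sum_{i=1}^n(\phi(x_i)-\psi(x_i))^2$. For $\phi_0\in\mathfrak{K}(a,b,\kappa_1,\kappa_2)$ the local neighborhood is $$N(\phi_0) := \left\{\phi\in\mathcal{C}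 : \sup_{x\in[0,1]}|\phi(x)-\phi_0(x)| \le \left(\frac{\kappa_2c_1^2}{32}\right)^{1/5}\left(\frac{\sigma^2}{n}\right)^{2/5}\right\},$$ and the local minimax risk is $$\mathfrak{R}_n(\phi_0) := \inf_{\hat\phi}\sup_{\phi\in N(\phi_0)}\mathbb{E}_\phi\,\ell^2(\phi,\hat\phi),$$ the infimum being over all possible estimators $\hat\phi$ (functions of the data).
   Formalization: Added hypothesis: the first and last design points satisfy n(x_1 − a) ≤ c_2 and n(b − x_n) ≤ c_2, so the design covers [a,b]; without it the claim is false, e.g. when n = 2, c_1 = c_2 is tiny, both points lie near 0, σ is large and [a,b] = [0,1]. *)

(* Defs.v *)
From HB Require Import structures.
From mathcomp Require Import all_boot all_order all_algebra.
From mathcomp Require Import all_classical all_reals all_analysis.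
Import Order.TTheory GRing.Theory Num.Theory.
Import numFieldNormedType.Exports.

Set Implicit Arguments.
Unset Strict Implicit.
Unset Printing Implicit Defensive.

Local Open Scope classical_set_scope.
Local Open Scope ring_scope.

(* Functions on [0, 1] are represented by total functions R -> R of which only
   the values on `[0, 1] are ever used. *)

Definition convex_on_unit (R : realType) : set (R -> R) :=
  [set phi | convex_function (`[0, 1]%classic : set R) phi].

(* The derivative relative to A: two-sided at interior points of A, one-sided
   at the end points when A is an interval. *)
Definition is_derivative_within (R : realType) (A : set R) (f : R -> R)
    (t l : R) : Prop :=
  (f y - f t) / (y - t) @[y --> within A t^'] --> l.

Definition curvature_class (R : realType) (a b k1 k2 : R) : set (R -> R) :=
  [set phi | convex_on_unit phi /\
    exists phi' phi'' : R -> R, forall t, t \in `[a, b] ->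
      [/\ is_derivative_within `[a, b] phi t (phi' t),
          is_derivative_within `[a, b] phi' t (phi'' t)
        & k1 <= phi'' t <= k2]].

(* The supremum is taken in \bar R because the supremum in R of an unbounded
   set is a junk value. *)
Definition local_nbhd (R : realType) (n : nat) (c1 sigma k2 : R)
    (phi0 : R -> R) : set (R -> R) :=
  [set phi | convex_on_unit phi /\
    (ereal_sup [set `|phi t - phi0 t|%:E | t in `[0%R, 1%R]] <=
     ((k2 * c1 ^+ 2 / 32) `^ (1 / 5) *
      (sigma ^+ 2 / n%:R) `^ (2 / 5))%:E)%E].

Definition empirical_loss (R : realType) (n : nat) (x : 'I_n -> R)
    (phi psi : R -> R) : R :=
  n%:R^-1 * \sum_(i < n) (phi (x i) - psi (x i)) ^+ 2.

Definition estimators (R : realType) (n : nat) : set (n.-tuple R -> R -> R) :=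
  [set phihat | forall t, t \in `[0, 1] ->
    measurable_fun [set: n.-tuple R] (phihat ^~ t)].

Definition gaussian_noise (d : measure_display) (T : measurableType d)
    (R : realType) (P : probability T R) (n : nat) (sigma : R)
    (xi : 'I_n -> {RV P >-> R}) : Prop :=
  (forall i (B : set R), measurable B ->
     distribution P (xi i) B = normal_prob 0 sigma B) /\
  (forall (J : {set 'I_n}) (B : 'I_n -> set R),
     (forall i, measurable (B i)) ->
     P (\bigcap_(i in [set` J]) (xi i @^-1` B i)) =
     (\prod_(i in J) P (xi i @^-1` B i))%E).

Section local_minimax_risk.
Context (d : measure_display) (T : measurableType d) (R : realType).
Variables (P : probability T R) (n : nat).
Variables (x : 'I_n -> R) (xi : 'I_n -> {RV P >-> R}).

Definition observations (phi : R -> R) (w : T) : n.-tuple R :=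
  [tuple phi (x i) + xi i w | i < n].

Definition risk (phi : R -> R) (phihat : n.-tuple R -> R -> R) : \bar R :=
  'E_P[fun w => empirical_loss x phi (phihat (observations phi w))].

Definition local_minimax_risk (c1 sigma k2 : R) (phi0 : R -> R) : \bar R :=
  ereal_inf [set ereal_sup [set risk phi phihat
                           | phi in local_nbhd n c1 sigma k2 phi0]
            | phihat in @estimators R n].

End local_minimax_risk.

Definition quasi_uniform_design (R : realType) (n : nat) (c1 c2 : R)
    (x : 'I_n -> R) : Prop :=
  [/\ forall i, 0 <= x i <= 1,
      forall i j : 'I_n, (i < j)%N -> x i < x j
    & forall i j : 'I_n, j = i.+1 :> nat ->
        c1 <= n%:R * (x j - x i) <= c2].

(* The first and last design points lie at most c2 / n inside [a, b], so that
   no margin of [a, b] uncovered by the design is longer than the largest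
   spacing inside the design.  The spacing condition alone does not give this:
   it lets the whole design sit in an interval of length c2, however small c2
   is, and then the lower bound, which carries a factor 1 / c2, can exceed the
   squared radius of local_nbhd, which bounds the worst-case risk of the
   constant estimator phi0. *)
Definition design_covers (R : realType) (n : nat) (c2 a b : R)
    (x : 'I_n -> R) : Prop :=
  forall i : 'I_n,
    (i = 0%N :> nat -> n%:R * (x i - a) <= c2) /\
    (i.+1 = n -> n%:R * (b - x i) <= c2).

(* Main.v *)
From HB Require Import structures.
Require Import Defs.
From mathcomp Require Import all_boot all_order all_algebra.
From mathcomp Require Import all_classical all_reals all_analysis.
From mathcomp Require Import measurable_realfun ring lra.
Import Order.TTheory GRing.Theory Num.Theory.
Import numFieldNormedType.Exports.

Set Implicit Arguments.
Unset Strict Implicit.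
Unset Printing Implicit Defensive.

Local Open Scope classical_set_scope.
Local Open Scope ring_scope.

(** The lower bound comes from a hypercube of hypotheses around phi0, built so
that convexity costs nothing.  On disjoint intervals of length L inside [a, b],
independently for each interval, keep phi0 or replace it by its chord.  Outside
its interval a chord lies below phi0, so the modified function is the maximum
of phi0 and of the selected chords, hence convex.  The curvature bounds
enclose the gap between chord and function on an interval [s, t] between
k1 / 2 and k2 / 2 times (z - s) (t - z) ([chord_defect_bounds]): the upper bound
keeps the perturbations in the neighbourhood and hard to detect, the lower
bound makes them matter for the loss.

The statistical part ([assouad]) compares two vertices of the hypercube that
differ in one bump.  If the squared bump values add up to at most sigma ^ 2,
then at a design point where the bump has value D no estimator has quadratic
risks summing to less than D ^ 2 / 4 under both vertices ([two_point_bound]).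
Averaging over the vertices gives a risk of at least 1 / (8 n) times the sum of
all the squared bump values.  The two-point bound needs the likelihood ratio of
a shifted Gaussian vector; it is obtained one coordinate at a time
([law_single_shift], [integral_shift]), and its second moment follows from the
change of measure itself ([integral_shift_likelihood_sqr]).

The numerical part is governed by rho = (c1 sigma^2 / (k2^2 n))^(1/5)
([bandwidth]): the neighbourhood has radius k2 rho^2 / 2, the claimed bound is
k1^2 (b - a) rho^4 / (4096 c2), and the condition on n says that
n rho >= 2 c2, i.e. that the spacing of the design is at most rho / 2.  Chords
over intervals of length 2 rho have height at most the radius, and each
interval holds between n rho / (2 c2) points in its middle half and
2 n rho / c1 + 1 points in all; this yields the bound when b - a >= 2 rho
([local_minimax_risk_ge_long]).  When b - a < 2 rho there may be no room for a
chord, but then the claimed bound is at most of the order of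
min (r^2, sigma^2 / n), r being the radius, and adding a constant to phi0 is
enough ([local_minimax_risk_ge_short]). *)

(** * Change of measure for the Gaussian distribution *)

Section density.
Local Open Scope ereal_scope.
Context d (T : measurableType d) (R : realType).

(** The density g is almost everywhere the Radon-Nikodym derivative, for which
the change of variables is known. *)
Lemma integral_density (nu : {finite_measure set T -> \bar R})
    (mu : {sigma_finite_measure set T -> \bar R}) (g f : T -> \bar R) :
  measurable_fun setT g -> (forall x, 0 <= g x) ->
  (forall A, measurable A -> nu A = \int[mu]_(x in A) g x) ->
  measurable_fun setT f -> (forall x, 0 <= f x) ->
  \int[nu]_x f x = \int[mu]_x (f x * g x).
Proof.
move=> mg g0 nug mf f0.
have numu : nu `<< mu.
  apply/null_content_dominatesP => A mA muA0; rewrite nug//.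
  by apply: null_set_integral => //; exact: measurable_funTS.
have intg : mu.-integrable [set: T] g.
  apply/integrableP; split => //.
  under eq_integral do rewrite gee0_abs//.
  by rewrite -nug// ltey_eq fin_num_measure.
rewrite -(Radon_Nikodym_SigmaFinite.change_of_variables numu)//.
apply: ae_eq_integral => //.
- apply: emeasurable_funM => //.
  exact: measurable_int (Radon_Nikodym_SigmaFinite.f_integrable numu).
- exact: emeasurable_funM.
apply: ae_eqe_mul2l.
apply: integral_ae_eq => //.
- exact: Radon_Nikodym_SigmaFinite.f_integrable.
- by move=> E _ mE; rewrite -Radon_Nikodym_SigmaFinite.f_integral// nug.
Qed.

End density.

Section gaussian_shift_1d.
Local Open Scope ereal_scope.
Context (R : realType) (sigma : R) (sigma0 : (sigma != 0)%R).

Local Notation mu := (@lebesgue_measure R).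

(** The density of the normal distribution of mean s with respect to the one of
mean 0, both of variance sigma ^ 2. *)
Definition likelihood_ratio (s y : R) : R :=
  expR ((s * y - s ^+ 2 / 2) / sigma ^+ 2).

Lemma measurable_likelihood_ratio s :
  measurable_fun [set: R] (likelihood_ratio s).
Proof.
apply: measurableT_comp => //; apply: measurable_funM => //.
by apply: measurable_funB => //; exact: measurable_funM.
Qed.

Lemma likelihood_ratio_ge0 s y : (0 <= likelihood_ratio s y)%R.
Proof. exact: expR_ge0. Qed.

Lemma normal_pdf_shift s y :
  normal_pdf 0 sigma (y - s) =
  (likelihood_ratio s y * normal_pdf 0 sigma y)%R.
Proof.
rewrite !normal_pdfE// /normal_fun mulrCA; congr (_ * _)%R.
by rewrite -expRD; congr expR; field.
Qed.

Lemma lebesgue_measure_shift (s : R) (A : set R) : measurable A ->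
  mu ((fun y => y + s)%R @^-1` A) = mu A.
Proof.
move=> mA.
pose f : R -> measurableTypeR R := (fun y => y + s)%R.
have mf : measurable_fun [set: R] f by exact: measurable_funD.
pose phi : {mfun R >-> measurableTypeR R} :=
  HB.pack f (isMeasurableFun.Build _ _ _ _ f mf).
rewrite -[LHS]/(pushforward mu phi A); apply/esym.
apply: lebesgue_measure_unique => //= _ [[a b]] _ <-.
rewrite /pushforward /=.
have -> : f @^-1` `]a, b]%classic = `](a - s)%R, (b - s)%R]%classic.
  by apply/seteqP; split => y /=; rewrite !in_itv/= /f ltrBlDr lerBrDr.
rewrite !lebesgue_measure_itv/= !lte_fin ltrD2r.
by case: ifP => // _; rewrite -!EFinD; congr EFin; ring.
Qed.

(** Both sides are the integral over B of the normal density of mean s: on the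
left after a translation of the Lebesgue measure, on the right after
factoring that density by [normal_pdf_shift]. *)
Lemma normal_prob_shift (s : R) (B : set R) : measurable B ->
  normal_prob 0 sigma ((fun y => y + s)%R @^-1` B) =
  \int[normal_prob 0 sigma]_(y in B) (likelihood_ratio s y)%:E.
Proof.
move=> mB.
have mpdf m : measurable_fun [set: R] (fun y => (normal_pdf m sigma y)%:E).
  by apply/measurable_EFinP; exact: measurable_normal_pdf.
have mlr : measurable_fun [set: R] (fun y => (likelihood_ratio s y)%:E).
  by apply/measurable_EFinP; exact: measurable_likelihood_ratio.
have mlrB :
    measurable_fun [set: R] ((fun y => (likelihood_ratio s y)%:E) \_ B).
  by apply/(measurable_restrictT _ mB); exact: measurable_funTS mlr.
have pdf0 m y : 0 <= (normal_pdf m sigma y)%:E by rewrite lee_fin normal_pdf_ge0.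
pose f : measurableTypeR R -> measurableTypeR R := (fun y => y + s)%R.
have mf : measurable_fun [set: R] f by exact: measurable_funD.
have mfB : measurable (f @^-1` B) by rewrite -[X in measurable X]setTI; exact: mf.
pose phi : {mfun measurableTypeR R >-> measurableTypeR R} :=
  HB.pack f (isMeasurableFun.Build _ _ _ _ f mf).
transitivity (\int[mu]_(y in f @^-1` B) (normal_pdf 0 sigma (f y - s))%:E).
  by apply: eq_integral => y _; rewrite /f addrK.
have mpdfs : measurable_fun [set: R] (fun y => (normal_pdf 0 sigma (y - s))%:E).
  apply: (measurableT_comp (mpdf 0%R)).
  exact: measurable_funB.
transitivity (\int[pushforward mu phi]_(y in B) (normal_pdf 0 sigma (y - s))%:E).
  rewrite ge0_integral_pushforward//; exact: measurable_funTS.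
transitivity (\int[mu]_(y in B) (normal_pdf 0 sigma (y - s))%:E).
  apply: eq_measure_integral => A mA _.
  exact: lebesgue_measure_shift.
rewrite [RHS]integral_mkcond (@integral_density _ _ _ _ mu
  (fun y => (normal_pdf 0 sigma y)%:E))//.
- rewrite [LHS]integral_mkcond; apply: eq_integral => y _.
  rewrite /patch; case: ifPn => yB; last by rewrite mul0e.
  by rewrite normal_pdf_shift EFinM.
- exact: mpdf.
- by move=> y; rewrite /patch; case: ifP => // _; rewrite lee_fin likelihood_ratio_ge0.
Qed.

End gaussian_shift_1d.

Section independence.
Local Open Scope ereal_scope.
Context d d' (T : measurableType d) (T' : measurableType d') (R : realType)
  (P : probability T R).

(** Independence makes the image by X of the restriction of P to A a multiple of
the distribution of X, so the expectation factors without any approximation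
of f by simple functions. *)
Lemma ge0_integral_independent (X : {mfun T >-> T'}) (A : set T)
    (f : T' -> \bar R) :
  measurable A -> measurable_fun [set: T'] f -> (forall y, 0 <= f y) ->
  (forall C, measurable C -> P (X @^-1` C `&` A) = P (X @^-1` C) * P A) ->
  \int[P]_(w in A) f (X w) = P A * \int[distribution P X]_y f y.
Proof.
move=> mA mf f0 indep.
have PAoo : P A < +oo by rewrite ltey_eq fin_num_measure.
have mfX : measurable_fun [set: T] (f \o X) by exact: measurableT_comp.
transitivity (\int[mfrestr mA PAoo]_w f (X w)).
  rewrite (@integral_density _ _ _ _ P (fun w => (\1_A w)%:E))//.
  - rewrite integral_mkcond; apply: eq_integral => w _.
    by rewrite epatch_indic.
  - by apply/measurable_EFinP; exact: measurable_indic.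
  - by move=> B mB; rewrite integral_indic//= /mfrestr /mrestr setIC.
rewrite -[LHS](@ge0_integral_pushforward _ _ _ _ _ X _ _ setT)//; last first.
have PAnum : (fine (P A))%:E = P A by rewrite fineK// fin_num_measure.
have PA0 : (0 <= fine (P A))%R by rewrite fine_ge0.
rewrite -[in RHS]PAnum -(ge0_integral_mscale _ measurableT (NngNum PA0))//.
apply: eq_measure_integral => C mC _.
by rewrite /= /pushforward /mfrestr /mrestr /= /mscale /= indep// PAnum muleC.
Qed.

End independence.

(** * Shifting one coordinate of a Gaussian vector *)

Section density_measure.
Local Open Scope ereal_scope.
Context d (T : measurableType d) (R : realType) (mu : {measure set T -> \bar R}).

Definition density_measure (g : T -> \bar R) & measurable_fun [set: T] g
  & (forall x, 0 <= g x) : set T -> \bar R := fun A => \int[mu]_(x in A) g x.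

Context (g : T -> \bar R) (mg : measurable_fun [set: T] g)
  (g0 : forall x, 0 <= g x).

Let density_measure0 : density_measure mg g0 set0 = 0.
Proof. exact: integral_set0. Qed.

Let density_measure_ge0 A : 0 <= density_measure mg g0 A.
Proof. exact: integral_ge0. Qed.

HB.instance Definition _ := isMeasure.Build _ _ _ (density_measure mg g0)
  density_measure0 density_measure_ge0 (semi_sigma_additive_nng_induced mg g0).

End density_measure.

Section rectangles.
Context (R : realType) (n : nat).

Definition rectangle (B : 'I_n -> set R) : set (n.-tuple R) :=
  [set y | forall i, B i (tnth y i)].

Definition rectangles : set (set (n.-tuple R)) :=
  [set rectangle B | B in [set B | forall i, measurable (B i)]].

Lemma measurable_rectangle B : (forall i, measurable (B i)) ->
  measurable (rectangle B).
Proof.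
move=> mB; rewrite (_ : rectangle B =
    \bigcap_(i in [set: 'I_n]) ((@tnth n R)^~ i @^-1` B i)).
  apply: fin_bigcap_measurable => // i _.
  by rewrite -[X in measurable X]setTI; exact: measurable_tnth.
by apply/seteqP; split => y By i; [move=> _|]; exact: (By i).
Qed.

(** Rectangles are stable under intersection, so two finite measures on tuples
that agree on them are equal. *)
Lemma measurable_tuple_rectangles :
  @measurable _ (n.-tuple R) = <<s rectangles >>.
Proof.
apply/seteqP; split; last first.
  apply: smallest_sub; first exact: sigma_algebra_measurable.
  by move=> _ [B mB <-]; exact: measurable_rectangle.
apply: smallest_sub; first exact: smallest_sigma_algebra.
move=> A; rewrite -bigcup_seq/= => -[i _] [B mB <-].
apply: sub_sigma_algebra.
exists (fun j => if j == i then B else setT) => [j|]; first by case: ifP.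
apply/seteqP; split => y /=.
  by move=> /(_ i); rewrite eqxx.
by move=> [_ By] j; case: eqP => // ->.
Qed.

Lemma rectangles_setI : setI_closed rectangles.
Proof.
move=> _ _ [B mB <-] [C mC <-].
exists (fun i => B i `&` C i) => [i|]; first exact: measurableI.
apply/seteqP; split => y /=; first by move=> BC; split => i; case: (BC i).
by move=> [By Cy] i; split.
Qed.

Lemma rectanglesT : rectangles setT.
Proof. by exists (fun=> setT) => //; apply/seteqP; split. Qed.

End rectangles.

Section gaussian_shift.
Local Open Scope ereal_scope.
Context d (T : measurableType d) (R : realType) (P : probability T R) (n : nat).
Context (sigma : R) (xi : 'I_n -> {RV P >-> R}).
Hypothesis sigma0 : (sigma != 0)%R.
Hypothesis xi_noise : gaussian_noise sigma xi.

Implicit Types c delta : 'I_n -> R.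

Definition noisy_vector c (w : T) : n.-tuple R := [tuple (c i + xi i w)%R | i < n].

Lemma measurable_noisy_vector c : measurable_fun [set: T] (noisy_vector c).
Proof.
apply/measurable_fun_tnthP => i.
rewrite (_ : _ \o _ = (fun w => (c i + xi i w)%R)); last first.
  by apply/funext => w /=; rewrite tnth_mktuple.
exact: measurable_funD.
Qed.

HB.instance Definition _ c := isMeasurableFun.Build _ _ _ _
  (noisy_vector c) (measurable_noisy_vector c).

Lemma ge0_integral_noisy_vector c (B : set (n.-tuple R)) (F : n.-tuple R -> \bar R) :
  measurable B -> measurable_fun [set: n.-tuple R] F -> (forall y, 0 <= F y) ->
  \int[distribution P (noisy_vector c)]_(y in B) F y =
  \int[P]_(w in noisy_vector c @^-1` B) F (noisy_vector c w).
Proof.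
move=> mB mF F0.
apply: (ge0_integral_pushforward (measurable_noisy_vector c) _ mB).
  exact: measurable_funTS.
by move=> y _; exact: F0.
Qed.

(** The product rule over all the coordinates, with C in place of B i, against
the product rule over the coordinates other than i. *)
Lemma noise_coordinate_independent (i : 'I_n) (B : 'I_n -> set R) (C : set R) :
  (forall j, measurable (B j)) -> measurable C ->
  let A := \bigcap_(j in [set` [set~ i]%SET]) (xi j @^-1` B j) in
  P (xi i @^-1` C `&` A) = P (xi i @^-1` C) * P A.
Proof.
move=> mB mC A.
pose B' j := if j == i then C else B j.
have mB' j : measurable (B' j) by rewrite /B'; case: ifP.
have -> : xi i @^-1` C `&` A =
    \bigcap_(j in [set` [set: 'I_n]%SET]) (xi j @^-1` B' j).
  apply/seteqP; split => w /=.
    move=> [Cw Aw] j _; rewrite /= /B'; case: eqP => [->//|/eqP ji].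
    by apply: Aw; rewrite /= !inE.
  move=> Bw; split; first by have := Bw i; rewrite /= /B' eqxx; apply; rewrite !inE.
  move=> j; rewrite /= !inE => ji; have := Bw j; rewrite /= /B' (negbTE ji).
  by apply; rewrite inE.
rewrite (xi_noise.2 _ _ mB') /A (xi_noise.2 _ _ mB).
rewrite (bigD1 i) ?inE//= /B' eqxx; congr (_ * _).
apply: eq_big => [j|j /andP[_ ji]]; first by rewrite !inE.
by rewrite (negbTE ji).
Qed.

Definition single_shift c (i : 'I_n) (s : R) : 'I_n -> R :=
  fun j => if j == i then (c j + s)%R else c j.

Lemma noisy_vector_rectangle c i (B : 'I_n -> set R) :
  noisy_vector c @^-1` rectangle B =
  xi i @^-1` [set y | B i (c i + y)%R] `&`
  \bigcap_(j in [set` [set~ i]%SET]) (xi j @^-1` [set y | B j (c j + y)%R]).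
Proof.
apply/seteqP; split => w /=.
  move=> Bw; split; first by have := Bw i; rewrite tnth_mktuple.
  by move=> j _ /=; have := Bw j; rewrite tnth_mktuple.
move=> [Biw Bw] j; rewrite tnth_mktuple.
have [->//|ji] := eqVneq j i.
by apply: Bw => /=; rewrite !inE.
Qed.

(** Both sides are finite measures in A, hence it suffices to compare them on
rectangles; there the coordinates other than i factor out by independence and
coordinate i is the one-dimensional statement [normal_prob_shift]. *)
Lemma law_single_shift c (i : 'I_n) (s : R) (A : set (n.-tuple R)) :
  measurable A ->
  P (noisy_vector (single_shift c i s) @^-1` A) =
  \int[P]_(w in noisy_vector c @^-1` A) (likelihood_ratio sigma s (xi i w))%:E.
Proof.
move=> mA.
pose g (y : n.-tuple R) := (likelihood_ratio sigma s (tnth y i - c i)%R)%:E.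
have mg : measurable_fun [set: n.-tuple R] g.
  apply/measurable_EFinP.
  apply: (measurableT_comp (measurable_likelihood_ratio _ _)).
  by apply: measurable_funB => //; exact: measurable_tnth.
have g0 y : 0 <= g y by rewrite lee_fin likelihood_ratio_ge0.
have gE w : g (noisy_vector c w) = (likelihood_ratio sigma s (xi i w))%:E.
  by rewrite /g tnth_mktuple addrAC subrr add0r.
have lawE B : measurable B -> \int[distribution P (noisy_vector c)]_(y in B) g y =
    \int[P]_(w in noisy_vector c @^-1` B) (likelihood_ratio sigma s (xi i w))%:E.
  move=> mB; rewrite (ge0_integral_noisy_vector _ mB mg g0).
  by apply: eq_integral => w _; rewrite gE.
rewrite -lawE//.
apply: (@measure_unique _ R _ (@rectangles R n) (fun=> setT) _ _ _ _
  (distribution P (noisy_vector (single_shift c i s)))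
  (density_measure (distribution P (noisy_vector c)) mg g0)) => //.
- exact: measurable_tuple_rectangles.
- exact: rectangles_setI.
- by move=> _; exact: rectanglesT.
- by rewrite bigcup_const.
- move=> _ [B mB <-].
  have mshift (j : 'I_n) (a : R) : measurable [set y | B j (a + y)%R].
    rewrite -[X in measurable X]setTI.
    have : measurable_fun [set: R] (fun y => a + y)%R by exact: measurable_funD.
    exact.
  apply: (eq_trans _ (esym (lawE _ (measurable_rectangle mB)))).
  rewrite /= /distribution /pushforward.
  rewrite !(noisy_vector_rectangle _ i).
  have -> : \bigcap_(j in [set` [set~ i]%SET])
      (xi j @^-1` [set y | B j (single_shift c i s j + y)%R]) =
    \bigcap_(j in [set` [set~ i]%SET]) (xi j @^-1` [set y | B j (c j + y)%R]).
    apply: eq_bigcapr => j; rewrite /= !inE => ji.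
    by rewrite /single_shift (negbTE ji).
  set A' := \bigcap_(j in _) _.
  set C := [set y | B i (c i + y)%R].
  have mA' : measurable A'.
    apply: fin_bigcap_measurable => // j _.
    rewrite -[X in measurable X]setTI.
    exact: (measurable_funPT (xi j)).
  have mC : measurable C by exact: mshift.
  have mlr : measurable_fun [set: R] (fun y => (likelihood_ratio sigma s y)%:E).
    by apply/measurable_EFinP; exact: measurable_likelihood_ratio.
  have mlrC : measurable_fun [set: R]
      ((fun y => (likelihood_ratio sigma s y)%:E) \_ C).
    by apply/(measurable_restrictT _ mC); exact: measurable_funTS mlr.
  have mXC : measurable (xi i @^-1` C).
    rewrite -[X in measurable X]setTI.
    exact: (measurable_funPT (xi i)).
  transitivity (P (xi i @^-1` ((fun y => y + s)%R @^-1` C)) * P A').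
    rewrite -noise_coordinate_independent//; last first.
      rewrite -[X in measurable X]setTI.
      by have : measurable_fun [set: R] (fun y => y + s)%R; [exact: measurable_funD|exact].
    congr (P (_ `&` _)); apply/seteqP; split => w;
      by rewrite /C /= /single_shift eqxx addrAC addrA.
  have lawi D : measurable D -> P (xi i @^-1` D) = normal_prob 0 sigma D.
    by move=> mD; rewrite -(xi_noise.1 i).
  rewrite lawi; last first.
    rewrite -[X in measurable X]setTI.
    by have : measurable_fun [set: R] (fun y => y + s)%R; [exact: measurable_funD|exact].
  rewrite normal_prob_shift// muleC.
  transitivity (\int[P]_(w in A')
      ((fun y => (likelihood_ratio sigma s y)%:E) \_ C) (xi i w)); last first.
    rewrite integral_mkcond [RHS]integral_mkcond; apply: eq_integral => w _.
    rewrite /patch in_setI; case: (boolP (w \in A')) => // _; last by rewrite andbF.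
    by rewrite andbT.
  have mxi : measurable_fun [set: T] (xi i : T -> measurableTypeR R).
    exact: (measurable_funPT (xi i)).
  pose X : {mfun T >-> measurableTypeR R} :=
    HB.pack (xi i : T -> measurableTypeR R) (isMeasurableFun.Build _ _ _ _ _ mxi).
  rewrite (@ge0_integral_independent _ _ _ _ _ P X)//.
  - congr (_ * _); rewrite integral_mkcond.
    by apply: eq_measure_integral => D mD _; exact: (esym (xi_noise.1 i D mD)).
  - by move=> y; rewrite /patch; case: ifP => // _; rewrite lee_fin likelihood_ratio_ge0.
  - by move=> D mD; exact: noise_coordinate_independent.
- by move=> _; rewrite (le_lt_trans (probability_le1 _ _)) ?ltry.
Qed.

End gaussian_shift.

(** * Full shifts and the two-point bound *)

Section gaussian_shift_integral.
Local Open Scope ereal_scope.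
Context d (T : measurableType d) (R : realType) (P : probability T R) (n : nat).
Context (sigma : R) (xi : 'I_n -> {RV P >-> R}).
Hypothesis sigma0 : (sigma != 0)%R.
Hypothesis xi_noise : gaussian_noise sigma xi.

Implicit Types c delta : 'I_n -> R.
Local Notation V := (noisy_vector xi).
Local Notation lr := (likelihood_ratio sigma).

Lemma integral_single_shift c (i : 'I_n) (s : R) (F : n.-tuple R -> \bar R) :
  measurable_fun [set: n.-tuple R] F -> (forall y, 0 <= F y) ->
  \int[P]_w F (V (single_shift c i s) w) =
  \int[P]_w (F (V c w) * (lr s (xi i w))%:E).
Proof.
move=> mF F0.
pose g (y : n.-tuple R) := (lr s (tnth y i - c i)%R)%:E.
have mg : measurable_fun [set: n.-tuple R] g.
  apply/measurable_EFinP.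
  apply: (measurableT_comp (measurable_likelihood_ratio _ _)).
  by apply: measurable_funB => //; exact: measurable_tnth.
have g0 y : 0 <= g y by rewrite lee_fin likelihood_ratio_ge0.
have gE w : g (V c w) = (lr s (xi i w))%:E.
  by rewrite /g tnth_mktuple addrAC subrr add0r.
have mFg : measurable_fun [set: n.-tuple R] (F \* g) by exact: emeasurable_funM.
have Fg0 y : 0 <= (F \* g) y by rewrite mule_ge0.
transitivity (\int[distribution P (V (single_shift c i s))]_y F y).
  by rewrite (ge0_integral_noisy_vector _ _ measurableT mF F0).
rewrite (@integral_density _ _ _ _ (distribution P (V c)) g)//.
  rewrite (ge0_integral_noisy_vector _ _ measurableT mFg Fg0).
  by apply: eq_integral => w _; rewrite gE.
move=> A mA; rewrite (ge0_integral_noisy_vector _ _ mA mg g0).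
rewrite [LHS](law_single_shift sigma0 xi_noise c i s mA).
by apply: eq_integral => w _; rewrite gE.
Qed.

Definition shift_likelihood delta (w : T) : R := (\prod_i lr (delta i) (xi i w))%R.

Lemma shift_likelihood_ge0 delta w : (0 <= shift_likelihood delta w)%R.
Proof. by apply: prodr_ge0 => i _; exact: likelihood_ratio_ge0. Qed.

Lemma measurable_shift_likelihood delta :
  measurable_fun [set: T] (shift_likelihood delta).
Proof.
apply: measurable_prod => i _.
exact: (measurableT_comp (measurable_likelihood_ratio _ _)).
Qed.

(** Shift the coordinates one after the other.  Every step multiplies the
integrand by a function of a coordinate that the other steps leave alone, which
is why the factors accumulate to a product evaluated at the unshifted vector. *)
Lemma integral_shift c delta (F : n.-tuple R -> \bar R) :
  measurable_fun [set: n.-tuple R] F -> (forall y, 0 <= F y) ->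
  \int[P]_w F (V (fun i => c i + delta i)%R w) =
  \int[P]_w (F (V c w) * (shift_likelihood delta w)%:E).
Proof.
move=> mF F0.
pose part (r : seq 'I_n) i := if i \in r then (c i + delta i)%R else c i.
(* [part r] is the vector whose coordinates in r have been shifted. *)
suff key (r : seq 'I_n) : uniq r -> forall G : n.-tuple R -> \bar R,
    measurable_fun [set: n.-tuple R] G -> (forall y, 0 <= G y) ->
    \int[P]_w G (V (part r) w) =
    \int[P]_w (G (V c w) * (\prod_(i <- r) lr (delta i) (xi i w))%:E).
  rewrite -(key (index_enum _)) ?index_enum_uniq//.
  have -> // : (fun i => c i + delta i)%R = part (index_enum 'I_n).
  by apply/funext => i; rewrite /part mem_index_enum.
elim: r => [_ G mG G0|i r IH /= /andP[ir ur] G mG G0].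
  have -> : part [::] = c by [].
  by apply: eq_integral => w _; rewrite big_nil mule1.
have -> : part (i :: r) = single_shift (part r) i (delta i).
  apply/funext => j; rewrite /part /single_shift inE.
  by have [->|] := eqVneq j i; rewrite ?(negbTE ir).
rewrite integral_single_shift//.
pose G' y := G y * (lr (delta i) (tnth y i - c i)%R)%:E.
transitivity (\int[P]_w G' (V (part r) w)).
  apply: eq_integral => w _; rewrite /G' tnth_mktuple /part (negbTE ir).
  by rewrite addrAC subrr add0r.
rewrite IH//.
- apply: eq_integral => w _; rewrite big_cons /G' tnth_mktuple.
  by rewrite addrAC subrr add0r EFinM muleA.
- apply: emeasurable_funM => //; apply/measurable_EFinP.
  apply: (measurableT_comp (measurable_likelihood_ratio _ _)).
  by apply: measurable_funB => //; exact: measurable_tnth.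
- by move=> y; rewrite mule_ge0// lee_fin likelihood_ratio_ge0.
Qed.

Lemma integral_shift_likelihood delta :
  \int[P]_w (shift_likelihood delta w)%:E = 1.
Proof.
transitivity (\int[P]_w (cst 1 (V (fun=> 0%R) w) * (shift_likelihood delta w)%:E)).
  by apply: eq_integral => w _; rewrite /= mul1e.
rewrite -(integral_shift (fun=> 0%R) delta (F := cst 1))//=.
by rewrite integral_cst// mul1e; exact: probability_setT.
Qed.

(** The square Z ^ 2 is Z as a weight times Z as an integrand.  Undoing the change
of measure evaluates Z at the shifted noise, which multiplies Z by
exp (|delta|^2 / sigma^2); no Gaussian moment has to be computed. *)
Lemma integral_shift_likelihood_sqr delta :
  \int[P]_w (shift_likelihood delta w ^+ 2)%:E =
  (expR ((\sum_i delta i ^+ 2) / sigma ^+ 2))%:E.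
Proof.
pose F (y : n.-tuple R) := (\prod_i lr (delta i) (tnth y i))%:E.
have F0 y : 0 <= F y.
  by rewrite lee_fin prodr_ge0// => i _; exact: likelihood_ratio_ge0.
have mF : measurable_fun [set: n.-tuple R] F.
  apply/measurable_EFinP; apply: measurable_prod => i _.
  apply: (measurableT_comp (measurable_likelihood_ratio _ _)).
  exact: measurable_tnth.
transitivity (\int[P]_w (F (V (fun=> 0%R) w) * (shift_likelihood delta w)%:E)).
  apply: eq_integral => w _; rewrite expr2 EFinM; congr (_%:E * _).
  by apply: eq_bigr => i _; rewrite tnth_mktuple add0r.
rewrite -integral_shift//.
transitivity (\int[P]_w ((expR ((\sum_i delta i ^+ 2) / sigma ^+ 2))%:E *
    (shift_likelihood delta w)%:E)).
  apply: eq_integral => w _; rewrite /F -EFinM; congr EFin.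
  rewrite /shift_likelihood mulr_suml expR_sum -big_split/=.
  apply: eq_bigr => i _; rewrite tnth_mktuple -expRD; congr expR.
  by rewrite add0r; field.
rewrite ge0_integralZl//.
- by rewrite integral_shift_likelihood mule1.
- by apply/measurable_EFinP; exact: measurable_shift_likelihood.
- by move=> w _; rewrite lee_fin shift_likelihood_ge0.
Qed.

(** Minimizing the risk part over p leaves D^2 z / (1 + z); the claim is then the
tangent line bound of 1 / (1 + z) at z = 3, written without division.  The
point 3 bounds the second moment of the likelihood ratio, which is at most exp 1. *)
Lemma two_point_pointwise (p D z : R) : (0 <= z)%R ->
  (7 / 16 * D ^+ 2 * z <=
   p ^+ 2 + (p - D) ^+ 2 * z + D ^+ 2 / 16 * z ^+ 2)%R.
Proof.
move=> z0; have z1 : (0 < 1 + z)%R by lra.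
rewrite -subr_ge0 -(pmulr_rge0 _ z1).
rewrite [X in (0 <= X)%R](_ : _ =
  (p * (1 + z) - D * z) ^+ 2 + D ^+ 2 * z * (z - 3) ^+ 2 / 16)%R; last by field.
rewrite addr_ge0 ?sqr_ge0// divr_ge0// mulr_ge0 ?sqr_ge0//.
by rewrite mulr_ge0 ?sqr_ge0.
Qed.

(** Move both risks to the same probability space by [integral_shift] and integrate
[two_point_pointwise]; the likelihood ratio has mean 1 and second moment at
most 3, and 7 / 16 - 3 / 16 = 1 / 4. *)
Lemma two_point_bound c delta (h : n.-tuple R -> R) (a D : R) :
  measurable_fun [set: n.-tuple R] h ->
  (\sum_i delta i ^+ 2 <= sigma ^+ 2)%R ->
  (D ^+ 2 / 4)%:E <=
  \int[P]_w ((h (V c w) - a) ^+ 2)%:E +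
  \int[P]_w ((h (V (fun i => c i + delta i)%R w) - (a + D)) ^+ 2)%:E.
Proof.
move=> mh dsigma.
have mhB e : measurable_fun [set: n.-tuple R] (fun y => ((h y - e) ^+ 2)%:E).
  by apply/measurable_EFinP; apply: measurable_funX; exact: measurable_funB.
have mV e : measurable_fun [set: T] (fun w => ((h (V c w) - e) ^+ 2)%:E).
  exact: (measurableT_comp (mhB e) (measurable_noisy_vector xi c)).
have mZ : measurable_fun [set: T] (fun w => (shift_likelihood delta w)%:E).
  by apply/measurable_EFinP; exact: measurable_shift_likelihood.
have mZ2 : measurable_fun [set: T] (fun w => (shift_likelihood delta w ^+ 2)%:E).
  apply/measurable_EFinP; apply: measurable_funX.
  exact: measurable_shift_likelihood.
have Z0 w : 0 <= (shift_likelihood delta w)%:E.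
  by rewrite lee_fin shift_likelihood_ge0.
rewrite (integral_shift c delta (F := fun y => ((h y - (a + D)) ^+ 2)%:E))//; last first.
  by move=> y; rewrite lee_fin sqr_ge0.
have e3 : (D ^+ 2 / 16 * expR ((\sum_i delta i ^+ 2) / sigma ^+ 2) <=
    D ^+ 2 / 16 * 3)%R.
  apply: ler_wpM2l; first by rewrite divr_ge0// sqr_ge0.
  apply: (@le_trans _ _ (expR 1)); last first.
    have e8 : (7 / 8 <= expR (- 8^-1) :> R)%R.
      by have := expR_ge1Dx (- 8^-1 : R)%R; lra.
      (* exp 1 <= (8 / 7) ^ 8 < 3, from exp (- 1 / 8) >= 7 / 8. *)
  have -> : (expR 1 = (expR (- 8^-1) ^+ 8)^-1 :> R)%R.
      by rewrite -expRM_natl -expRN; congr expR; field.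
    rewrite invf_ple ?posrE ?exprn_gt0 ?expR_gt0//.
    apply: (@le_trans _ _ ((7 / 8) ^+ 8)%R); first lra.
    by apply: lerXn2r => //; rewrite nnegrE ?expR_ge0//; lra.
  by rewrite ler_expR ler_pdivrMr ?mul1r// exprn_even_gt0.
have D160 : (0 <= D ^+ 2 / 16)%R by rewrite divr_ge0// sqr_ge0.
have f10 w : 0 <= ((h (V c w) - a) ^+ 2)%:E by rewrite lee_fin sqr_ge0.
have f20 w : 0 <= ((h (V c w) - (a + D)) ^+ 2)%:E * (shift_likelihood delta w)%:E.
  by rewrite mule_ge0// lee_fin sqr_ge0.
have f30 w : 0 <= (D ^+ 2 / 16)%:E * (shift_likelihood delta w ^+ 2)%:E.
  by rewrite mule_ge0// lee_fin sqr_ge0.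
have m2 : measurable_fun [set: T] (fun w =>
    ((h (V c w) - (a + D)) ^+ 2)%:E * (shift_likelihood delta w)%:E).
  exact: emeasurable_funM.
have m3 : measurable_fun [set: T] (fun w =>
    (D ^+ 2 / 16)%:E * (shift_likelihood delta w ^+ 2)%:E).
  exact: emeasurable_funM.
have m12 := emeasurable_funD (mV a) m2.
have main : (7 / 16 * D ^+ 2)%:E <=
    (\int[P]_w ((h (V c w) - a) ^+ 2)%:E +
     \int[P]_w (((h (V c w) - (a + D)) ^+ 2)%:E * (shift_likelihood delta w)%:E))
    + (D ^+ 2 / 16 * expR ((\sum_i delta i ^+ 2) / sigma ^+ 2))%:E.
  rewrite [X in _ + X]EFinM -integral_shift_likelihood_sqr -ge0_integralZl//; last first.
    by move=> w _; rewrite lee_fin sqr_ge0.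
  rewrite -ge0_integralD// -ge0_integralD//; last by move=> w _; rewrite adde_ge0.
  rewrite -[leLHS]mule1 -(integral_shift_likelihood delta) -ge0_integralZl//; last first.
    by rewrite lee_fin mulr_ge0 ?sqr_ge0.
  apply: ge0_le_integral => //.
  - by move=> w _; rewrite mule_ge0// lee_fin mulr_ge0 ?sqr_ge0.
  - exact: emeasurable_funM.
  - exact: emeasurable_funD.
  - move=> w _; rewrite -!EFinM -!EFinD lee_fin.
    have := two_point_pointwise (h (V c w) - a) D (shift_likelihood_ge0 delta w).
    by rewrite opprD addrA.
have {}main := le_trans main (leeD2l _ (e3 : (_%:E <= _%:E))).
rewrite -leeBlDr// in main.
apply: le_trans main; rewrite -EFinB lee_fin.
lra.
Qed.

End gaussian_shift_integral.

(** * Assouad's lemma for sums of bumps *)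

Section hypercube.
Context (R : realType) (m n : nat).

Definition flip (j : 'I_m) (tau : {set 'I_m}) : {set 'I_m} :=
  if j \in tau then tau :\ j else j |: tau.

Lemma flipK j : involutive (flip j).
Proof.
move=> tau; rewrite /flip; case: (boolP (j \in tau)) => jt.
  by rewrite !inE eqxx/= finset.setD1K.
by rewrite !inE eqxx/= finset.setU1K.
Qed.

(** Summed over the whole hypercube, the pairs (tau, flip j tau) count every vertex
twice.  Disjointness allows at most one bump j to be charged to each index i. *)
Lemma hypercube_average (r : {set 'I_m} -> 'I_n -> R) (v : 'I_m -> 'I_n -> R)
    (B : R) :
  (forall tau i, 0 <= r tau i) ->
  (forall i j k, j != k -> v j i = 0 \/ v k i = 0) ->
  (forall tau i j, v j i <= r tau i + r (flip j tau) i) ->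
  (forall tau, \sum_i r tau i <= B) ->
  \sum_j \sum_i v j i <= 2 * B.
Proof.
move=> r0 disj vr rB.
have per_i i : (\sum_j v j i) *+ #|{set 'I_m}| <= 2 * \sum_tau r tau i.
  have [[j vj0]|no] := pselect (exists j, v j i != 0); last first.
    rewrite big1 ?mul0rn; last first.
      by move=> j _; apply: contrapT => /eqP vj0; apply: no; exists j.
    by rewrite mulr_ge0// sumr_ge0.
  rewrite (bigD1 j)//= big1 ?addr0; last first.
    by move=> k kj; case: (disj i k j kj) => // vj; rewrite vj eqxx in vj0.
  rewrite -sumr_const.
  apply: (@le_trans _ _ (\sum_(tau : {set 'I_m}) (r tau i + r (flip j tau) i))).
    by rewrite ler_sum.
  rewrite big_split/= mulr2n mulrDl !mul1r lerD2l.
  rewrite [leRHS](reindex_inj (inv_inj (flipK j)))//=.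
have c0 : 0 < #|{set 'I_m}|%:R :> R.
  by rewrite ltr0n; apply/card_gt0P; exists finset.set0.
rewrite -(ler_pM2r c0) mulr_natr exchange_big/= -sumrMnl.
apply: (@le_trans _ _ (\sum_i 2 * \sum_(tau : {set 'I_m}) r tau i)).
  by rewrite ler_sum.
rewrite -mulr_sumr exchange_big/= -mulrA ler_wpM2l// mulr_natr -sumr_const.
by rewrite ler_sum.
Qed.

End hypercube.

Section assouad.
Context d (T : measurableType d) (R : realType) (P : probability T R) (n : nat).
Context (sigma : R) (xi : 'I_n -> {RV P >-> R}) (x : 'I_n -> R).
Hypothesis sigma0 : sigma != 0.
Hypothesis xi_noise : gaussian_noise sigma xi.
Hypothesis n0 : (0 < n)%N.
Hypothesis x01 : forall i, 0 <= x i <= 1.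

Definition perturb m (phi0 : R -> R) (bump : 'I_m -> R -> R) (tau : {set 'I_m})
  : R -> R := fun t => phi0 t + \sum_(j in tau) bump j t.

Definition coordinate_risk (phi : R -> R) (phihat : n.-tuple R -> R -> R)
    (i : 'I_n) : \bar R :=
  (\int[P]_w ((phihat (noisy_vector xi (phi \o x) w) (x i) - phi (x i)) ^+ 2)%:E)%E.

Lemma measurable_estimator phihat (i : 'I_n) : @estimators R n phihat ->
  measurable_fun [set: n.-tuple R] (phihat ^~ (x i)).
Proof. by move=> ephi; apply: ephi; rewrite in_itv/=. Qed.

Lemma coordinate_risk_ge0 phi phihat i : (0 <= coordinate_risk phi phihat i)%E.
Proof. by apply: integral_ge0 => w _; rewrite lee_fin sqr_ge0. Qed.

Lemma risk_coordinates phi phihat : @estimators R n phihat ->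
  risk x xi phi phihat =
  (n%:R^-1%:E * \sum_i coordinate_risk phi phihat i)%E.
Proof.
move=> ephi; rewrite /risk unlock /empirical_loss /coordinate_risk.
have mi i : measurable_fun [set: T] (fun w =>
    ((phihat (noisy_vector xi (phi \o x) w) (x i) - phi (x i)) ^+ 2)%:E).
  apply/measurable_EFinP; apply: measurable_funX; apply: measurable_funB => //.
  exact: (measurableT_comp (measurable_estimator i ephi) (measurable_noisy_vector _ _)).
rewrite -ge0_integral_sum//; last by move=> i w _; rewrite lee_fin sqr_ge0.
rewrite -ge0_integralZl//; last 2 first.
- exact: emeasurable_sum.
- by move=> w _; apply: sume_ge0 => i _; rewrite lee_fin sqr_ge0.
apply: eq_integral => w _.
rewrite EFinM -sumEFin; congr (_ * _)%E; apply: eq_bigr => i _.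
by congr EFin; rewrite -sqrrN opprB.
Qed.

(** Apply [hypercube_average] to the risks at single design points; each edge of
the hypercube is an instance of [two_point_bound]. *)
Lemma assouad m (phi0 : R -> R) (bump : 'I_m -> R -> R)
    (phihat : n.-tuple R -> R -> R) (S : \bar R) :
  (forall j, \sum_i bump j (x i) ^+ 2 <= sigma ^+ 2) ->
  (forall i j k, j != k -> bump j (x i) = 0 \/ bump k (x i) = 0) ->
  @estimators R n phihat ->
  (forall tau, (risk x xi (perturb phi0 bump tau) phihat <= S)%E) ->
  (((8 * n%:R)^-1 * \sum_j \sum_i bump j (x i) ^+ 2)%:E <= S)%E.
Proof.
move=> bsigma disj ephi riskS.
have nR0 : 0 < n%:R :> R by rewrite ltr0n.
pose e tau i := coordinate_risk (perturb phi0 bump tau) phihat i.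
have {}riskS tau : (\sum_i e tau i <= n%:R%:E * S)%E.
  have := riskS tau; rewrite risk_coordinates//.
  move=> /(lee_wpmul2l (_ : 0 <= n%:R%:E)%E); rewrite lee_fin ler0n => /(_ isT).
  by rewrite muleA -EFinM mulfV ?mul1e// gt_eqF.
have e0 tau i : (0 <= e tau i)%E by exact: coordinate_risk_ge0.
case: S riskS => [s|_|riskS]; last first.
- have := riskS finset.set0; rewrite gt0_muleNy ?lte_fin// => h.
  have s0 : (0 <= \sum_i e finset.set0 i)%E by apply: sume_ge0.
  by have := le_trans s0 h.
- by rewrite leey.
rewrite -EFinM => riskS.
(* If S is a real number, all the risks are finite and the averaging takes place
   in R. *)
have efin tau i : e tau i \is a fin_num.
  rewrite ge0_fin_numE//; apply: le_lt_trans (ltry (n%:R * s)).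
  apply: le_trans (riskS tau).
  by rewrite (bigD1 i)//= leeDl// sume_ge0.
rewrite lee_fin ler_pdivrMl ?mulr_gt0//.
have := @hypercube_average R m n (fun tau i => fine (e tau i))
  (fun j i => bump j (x i) ^+ 2 / 4) (n%:R * s).
set lhs := (X in _ -> _ -> _ -> _ -> X <= _) => H.
have -> : \sum_j \sum_i bump j (x i) ^+ 2 = 4 * lhs.
  rewrite /lhs mulr_sumr; apply: eq_bigr => j _.
  by rewrite mulr_sumr; apply: eq_bigr => i _; field.
suff : lhs <= 2 * (n%:R * s) by lra.
apply: {lhs} H.
- by move=> tau i; rewrite fine_ge0.
- move=> i j k jk; case: (disj i j k jk) => ->; [left|right];
    by rewrite expr0n/= mul0r.
- have key (tau : {set 'I_m}) i j : j \notin tau ->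
    bump j (x i) ^+ 2 / 4 <= fine (e tau i) + fine (e (j |: tau) i).
    move=> jt; rewrite -lee_fin EFinD !fineK//.
    have := two_point_bound sigma0 xi_noise (perturb phi0 bump tau \o x)
      (perturb phi0 bump tau (x i)) (bump j (x i)) (measurable_estimator i ephi)
      (bsigma j).
    congr (_ <= _ + _)%E; rewrite /e /coordinate_risk.
    have pE t : perturb phi0 bump (j |: tau) t = perturb phi0 bump tau t + bump j t.
      by rewrite /perturb big_setU1//= addrA addrAC.
    rewrite pE; apply: eq_integral => w _.
    by congr ((phihat (noisy_vector xi _ w) (x i) - _) ^+ 2)%:E; apply/funext => k /=.
  move=> tau i j; rewrite /flip; case: ifPn => jt; last exact: key.
  have := key (tau :\ j) i j; rewrite finset.setD1K// addrC; apply.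
  by rewrite !inE eqxx.
- move=> tau; rewrite -lee_fin; apply: le_trans (riskS tau).
  by rewrite -sumEFin; apply: lee_sum => i _; rewrite fineK.
Qed.

End assouad.

(** * Chords of a function of bounded curvature *)

Section derivative_within.
Context (R : realType) (a b : R).
Local Notation A := (`[a, b]%classic : set R).

Lemma is_derivative_within_near (f : R -> R) (t l : R) (U : set R) :
  is_derivative_within A f t l -> nbhs l U ->
  \forall y \near t, y != t -> A y -> U ((f y - f t) / (y - t)).
Proof. by move=> ft /ft. Qed.

(** Multiplying the difference quotient by y - t recovers f y - f t. *)
Lemma is_derivative_within_continuous (f : R -> R) (t l : R) :
  is_derivative_within A f t l -> f @ within A (nbhs t) --> f t.
Proof.
move=> ft.
have lim0 : (f t + (f y - f t) / (y - t) * (y - t))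
    @[y --> within A t^'] --> f t + l * (t - t).
  apply: cvgD; first exact: cvg_cst.
  apply: cvgM => //; apply: cvgB; last exact: cvg_cst.
  apply: cvg_trans (cvg_within _) _; exact: cvg_within.
rewrite subrr mulr0 addr0 in lim0.
move=> U Ut; have H : \forall y \near t, y != t -> A y ->
    U (f t + (f y - f t) / (y - t) * (y - t)) by exact: lim0.
suff : \forall y \near t, A y -> U (f y) by [].
apply: filterS H => y Hy Ay.
have [->|yt] := eqVneq y t; first exact: nbhs_singleton.
by have := Hy yt Ay; rewrite divfK ?subr_eq0// addrC subrK.
Qed.

Lemma is_derivative_within_is_derive (f : R -> R) (t l : R) : t \in `]a, b[ ->
  is_derivative_within A f t l -> is_derive t 1 f l.
Proof.
move=> tab ft.
have lim : h^-1 *: ((f \o shift t) (h *: 1) - f t) @[h --> 0^'] --> l.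
  move=> U Ul; have H := is_derivative_within_near ft Ul.
  have tA : \forall y \near t, y \in `]a, b[ by exact: near_in_itvoo.
  pose Q y := (y != t -> A y -> U ((f y - f t) / (y - t))) /\ y \in `]a, b[.
  have HQ : \forall y \near t, Q y by exact: filterI H tA.
  have K : \forall h \near (0 : R), Q (h + t).
    by have := HQ; rewrite (near_shift (0 : R) t Q) subr0.
  suff : \forall h \near (0 : R), h != 0 ->
    U (h^-1 *: ((f \o shift t) (h *: 1) - f t)) by [].
  apply: filterS K => h /= [K1 K2] h0.
  have ht : h + t != t by rewrite -subr_eq0 addrK.
  have := K1 ht (subset_itv_oo_cc K2).
  by rewrite addrK mulrC /GRing.scale/= mulr1.
split; first by apply/cvg_ex; exists l.
exact: cvg_lim.
Qed.

End derivative_within.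

Section chord.
Context (R : realType).

(** The mean value theorem turns the slopes of the two sides into f' p and f' q
with p < q, and a second application to f' compares these. *)
Lemma second_derivative_ge0_chord (f f' f'' : R -> R) (a b s z t : R) :
  {within `[a, b], continuous f} ->
  (forall x, x \in `]a, b[ -> is_derive x 1 f (f' x)) ->
  (forall x, x \in `]a, b[ -> is_derive x 1 f' (f'' x)) ->
  (forall x, x \in `]a, b[ -> 0 <= f'' x) ->
  a <= s -> s < z -> z < t -> t <= b ->
  (f z - f s) * (t - z) <= (f t - f z) * (z - s).
Proof.
move=> cf df df' f''0 as_ sz zt tb.
have sub (u v : R) : a <= u -> v <= b -> forall x, x \in `]u, v[ -> x \in `]a, b[.
  by move=> au vb x; rewrite !in_itv/= => /andP[ux xv]; apply/andP; split; lra.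
have wc (u v : R) : a <= u -> v <= b -> {within `[u, v], continuous f}.
  move=> au vb; apply: continuous_subspaceW cf => x /=; rewrite !in_itv/=.
  by move=> /andP[ux xv]; apply/andP; split; lra.
have zb : z <= b by lra.
have az : a <= z by lra.
have [p psz fp] := MVT sz (fun x xin => df x (sub s z as_ zb x xin)) (wc _ _ as_ zb).
have [q qzt fq] := MVT zt (fun x xin => df x (sub z t az tb x xin)) (wc _ _ az tb).
have [sp pz] : s < p /\ p < z by move: psz; rewrite in_itv/= => /andP.
have [zq qt] : z < q /\ q < t by move: qzt; rewrite in_itv/= => /andP.
have pq : p < q by lra.
have ap : a <= p by lra.
have qb : q <= b by lra.
have dfpq x : x \in `[p, q] -> is_derive x 1 f' (f'' x).
  move=> xpq; apply: df'; move: xpq; rewrite !in_itv/= => /andP[px xq].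
  by apply/andP; split; lra.
have cf' : {within `[p, q], continuous f'}.
  apply: derivable_within_continuous => x xpq.
  by have := dfpq x xpq; case.
have [c cpq fc] := MVT pq (fun x xin => dfpq x (subset_itv_oo_cc xin)) cf'.
have c0 : 0 <= f'' c by apply: f''0; exact: sub cpq.
have pq' : f' p <= f' q by rewrite -subr_ge0 fc mulr_ge0// subr_ge0 ltW.
rewrite fp fq mulrAC; apply: ler_wpM2r; first by rewrite subr_ge0 ltW.
by apply: ler_wpM2r => //; rewrite subr_ge0 ltW.
Qed.

Definition chord (f : R -> R) (s t z : R) : R :=
  f s + (f t - f s) / (t - s) * (z - s).

(** The defect of the chord of y |-> c / 2 * y ^ 2 is exactly
c / 2 * (z - s) * (t - z), and the difference between phi and such a function
with c = k1, resp. c = k2, is convex, resp. concave. *)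
Lemma chord_defect_bounds (a b k1 k2 : R) (phi : R -> R) (s z t : R) :
  curvature_class a b k1 k2 phi ->
  a <= s -> s < z -> z < t -> t <= b ->
  k1 / 2 * ((z - s) * (t - z)) <= chord phi s t z - phi z <=
  k2 / 2 * ((z - s) * (t - z)).
Proof.
move=> [_ [phi' [phi'' H]]] as_ sz zt tb.
have cphi : {within `[a, b], continuous phi}.
  apply/subspace_continuousP => x xab.
  by have [h _ _] := H x xab; exact: is_derivative_within_continuous h.
have d1 x : x \in `]a, b[ -> is_derive x 1 phi (phi' x).
  move=> xab; have [h _ _] := H x (subset_itv_oo_cc xab).
  exact: is_derivative_within_is_derive h.
have d2 x : x \in `]a, b[ -> is_derive x 1 phi' (phi'' x).
  move=> xab; have [_ h _] := H x (subset_itv_oo_cc xab).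
  exact: is_derivative_within_is_derive h.
have dq (c x : R) : is_derive x 1 (fun y : R => c * y ^+ 2) (2 * c * x).
  apply: is_derive_eq; rewrite /GRing.scale/=; ring.
have dl (c x : R) : is_derive x 1 (fun y : R => c * y) c.
  by apply: is_derive_eq; rewrite /GRing.scale/=; ring.
have cq (c : R) : {within `[a, b], continuous (fun y : R => c * y ^+ 2)}.
  by apply: derivable_within_continuous => x _; case: (dq c x).
have st : 0 < t - s by lra.
have chordE : (chord phi s t z - phi z) * (t - s) =
  (phi t - phi z) * (z - s) - (phi z - phi s) * (t - z).
  by rewrite /chord; field; lra.
rewrite -(ler_pM2r st) -[X in _ && X](ler_pM2r st) chordE.
apply/andP; split.
- have := @second_derivative_ge0_chord (fun y => phi y - k1 / 2 * y ^+ 2)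
    (fun y => phi' y - k1 * y) (fun y => phi'' y - k1) a b s z t.
  move=> h; suff : (phi z - k1 / 2 * z ^+ 2 - (phi s - k1 / 2 * s ^+ 2)) * (t - z)
     <= (phi t - k1 / 2 * t ^+ 2 - (phi z - k1 / 2 * z ^+ 2)) * (z - s) by lra.
  apply: (h _ _ _ _ as_ sz zt tb) => [x|x xab|x xab|x xab].
  + by apply: cvgB; [exact: cphi|exact: cq].
  + have := d1 x xab; have := dq (k1 / 2) x => h1 h2.
    by apply: is_derive_eq; field.
  + have := d2 x xab; have := dl k1 x => h1 h2.
    by apply: is_derive_eq.
  + by have [_ _ /andP[? ?]] := H x (subset_itv_oo_cc xab); rewrite subr_ge0.
- have := @second_derivative_ge0_chord (fun y => k2 / 2 * y ^+ 2 - phi y)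
    (fun y => k2 * y - phi' y) (fun y => k2 - phi'' y) a b s z t.
  move=> h; suff : (k2 / 2 * z ^+ 2 - phi z - (k2 / 2 * s ^+ 2 - phi s)) * (t - z)
     <= (k2 / 2 * t ^+ 2 - phi t - (k2 / 2 * z ^+ 2 - phi z)) * (z - s) by lra.
  apply: (h _ _ _ _ as_ sz zt tb) => [x|x xab|x xab|x xab].
  + by apply: cvgB; [exact: cq|exact: cphi].
  + have := d1 x xab; have := dq (k2 / 2) x => h1 h2.
    by apply: is_derive_eq; field.
  + have := d2 x xab; have := dl k2 x => h1 h2.
    by apply: is_derive_eq.
  + by have [_ _ /andP[? ?]] := H x (subset_itv_oo_cc xab); rewrite subr_ge0.
Qed.

Lemma convex_on_unitP (f : R -> R) : convex_on_unit f <->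
  (forall u v t, 0 <= u <= 1 -> 0 <= v <= 1 -> 0 <= t <= 1 ->
     f (t * u + (1 - t) * v) <= t * f u + (1 - t) * f v).
Proof.
split=> [cf u v t u01 v01 t01|H t u v].
  have t01' : t \in `[0, 1] by rewrite in_itv.
  pose t' : {i01 R} := Itv01 (andP t01).1 (andP t01).2.
  have := cf t' u v; rewrite !inE /= !in_itv/= u01 v01.
  by move=> /(_ isT isT); rewrite !convRE.
rewrite !inE /= !in_itv/= => u01 v01.
by rewrite !convRE; apply: H => //; apply/andP; split.
Qed.

Lemma convex_three_points (f : R -> R) (u v w : R) : convex_on_unit f ->
  0 <= u -> u <= v -> v <= w -> w <= 1 ->
  f v * (w - u) <= (w - v) * f u + (v - u) * f w.
Proof.
move=> /convex_on_unitP cf u0 uv vw w1.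
have [uw|uw] := leP w u.
  have wv : w = v by lra.
  have uv' : u = v by lra.
  by rewrite wv uv' !subrr !(mul0r, mulr0) addr0.
have wu0 : 0 < w - u by lra.
have /= := cf u w ((w - v) / (w - u)).
have -> : 1 - (w - v) / (w - u) = (v - u) / (w - u) by field; lra.
have -> : (w - v) / (w - u) * u + (v - u) / (w - u) * w = v by field; lra.
move=> h; have {}h : f v <= (w - v) / (w - u) * f u + (v - u) / (w - u) * f w.
  apply: h; [lra|lra|apply/andP; split].
    by rewrite divr_ge0//; lra.
  by rewrite ler_pdivrMr//; lra.
rewrite -ler_pdivlMr//; apply: le_trans h _.
by rewrite le_eqVlt; apply/orP; left; apply/eqP; field; lra.
Qed.

Lemma chord_le_outside (f : R -> R) (s t z : R) : convex_on_unit f ->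
  0 <= s -> s < t -> t <= 1 -> 0 <= z <= 1 -> z <= s \/ t <= z ->
  chord f s t z <= f z.
Proof.
move=> cf s0 st t1 /andP[z0 z1] out.
have ts0 : 0 < t - s by lra.
rewrite -(ler_pM2r ts0).
have -> : chord f s t z * (t - s) = f s * (t - s) + (f t - f s) * (z - s).
  by rewrite /chord; field; lra.
case: out => [zs|tz].
- have := convex_three_points cf z0 zs (ltW st) t1; lra.
- have := convex_three_points cf s0 (ltW st) tz z1; lra.
Qed.

End chord.

(** * The perturbations of phi0 by its chords *)

Section chord_family.
Context (R : realType) (phi0 : R -> R) (a L : R) (m : nat).
Hypothesis phi0_convex : convex_on_unit phi0.
Hypothesis L0 : 0 < L.
Hypothesis a0 : 0 <= a.
Hypothesis m1 : a + L *+ m <= 1.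

Definition knot (j : nat) : R := a + L *+ j.

Definition chord_bump (j : 'I_m) (t : R) : R :=
  Num.max 0 (chord phi0 (knot j) (knot j.+1) t - phi0 t).

Lemma knot_lt j : knot j < knot j.+1.
Proof. by rewrite /knot mulrS ltrD2l ltrDr. Qed.

Lemma knot_le j k : (j <= k)%N -> knot j <= knot k.
Proof. by move=> jk; rewrite /knot lerD2l ler_wpMn2l// ltW. Qed.

Lemma knot_ge0 j : 0 <= knot j.
Proof. by rewrite /knot addr_ge0// mulrn_wge0// ltW. Qed.

Lemma knot_le1 j : (j <= m)%N -> knot j <= 1.
Proof. by move=> jm; apply: le_trans m1; exact: knot_le. Qed.

Lemma chord_bump_ge0 j t : 0 <= chord_bump j t.
Proof. by rewrite /chord_bump le_max lexx. Qed.

Lemma chord_bump_support j t : 0 <= t <= 1 -> chord_bump j t != 0 ->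
  knot j < t < knot j.+1.
Proof.
move=> t01; apply: contraR; rewrite negb_and -!leNgt => out.
have := chord_le_outside phi0_convex (knot_ge0 j) (knot_lt j)
  (knot_le1 (ltn_ord j)) t01 (orP out).
by rewrite -subr_le0 /chord_bump => h; apply/eqP/max_idPl.
Qed.

Lemma chord_bump_disjoint j k t : 0 <= t <= 1 -> j != k ->
  chord_bump j t = 0 \/ chord_bump k t = 0.
Proof.
move=> t01 jk.
have [/eqP|/(chord_bump_support t01)/andP[jt tj]] := boolP (chord_bump j t == 0).
  by left.
have [/eqP|/(chord_bump_support t01)/andP[kt tk]] := boolP (chord_bump k t == 0).
  by right.
exfalso; move: jk; rewrite -(inj_eq val_inj) neq_ltn => /orP[] /knot_le h; lra.
Qed.

Lemma perturb_chord_ge tau t :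
  phi0 t <= perturb phi0 chord_bump tau t /\
  (forall j, j \in tau ->
     chord phi0 (knot j) (knot j.+1) t <= perturb phi0 chord_bump tau t).
Proof.
split=> [|j jt]; rewrite /perturb.
  by rewrite lerDl sumr_ge0// => j _; exact: chord_bump_ge0.
rewrite (bigD1 j)//=.
have : 0 <= \sum_(i in tau | i != j) chord_bump i t.
  by apply: sumr_ge0 => i _; exact: chord_bump_ge0.
have : chord phi0 (knot j) (knot j.+1) t - phi0 t <= chord_bump j t.
  by rewrite /chord_bump le_max lexx orbT.
lra.
Qed.

Lemma perturb_chord_cases tau t : 0 <= t <= 1 ->
  perturb phi0 chord_bump tau t = phi0 t \/
  exists2 j, j \in tau &
    perturb phi0 chord_bump tau t = phi0 t + chord_bump j t /\
    perturb phi0 chord_bump tau t = chord phi0 (knot j) (knot j.+1) t.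
Proof.
move=> t01.
have [[j [jt bj]]|no] := pselect (exists j, j \in tau /\ chord_bump j t != 0).
  right; exists j => //.
  have -> : perturb phi0 chord_bump tau t = phi0 t + chord_bump j t.
    rewrite /perturb (bigD1 j)//= big1 ?addr0// => k /andP[_ kj].
    by have [//|h] := chord_bump_disjoint t01 kj; rewrite h eqxx in bj.
  split=> //; move: bj; rewrite /chord_bump.
  by case: leP => _; rewrite ?eqxx// => _; ring.
left; rewrite /perturb big1 ?addr0// => j jt.
by apply: contrapT => /eqP bj; apply: no; exists j.
Qed.

(** At a given point the perturbation coincides with phi0 or with one selected
chord, and it dominates all of these everywhere: it is their maximum. *)
Lemma perturb_chord_convex tau : convex_on_unit (perturb phi0 chord_bump tau).
Proof.
apply/convex_on_unitP => u v t u01 v01 t01.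
set psi := perturb _ _ _.
have w01 : 0 <= t * u + (1 - t) * v <= 1.
  move: u01 v01 t01 => /andP[? ?] /andP[? ?] /andP[? ?].
  by apply/andP; split; nra.
have mono p q : p <= psi u -> q <= psi v ->
    t * p + (1 - t) * q <= t * psi u + (1 - t) * psi v.
  move: t01 => /andP[? ?] pu qv; apply: lerD; apply: ler_wpM2l => //; lra.
have [gu guj] := perturb_chord_ge tau u.
have [gv gvj] := perturb_chord_ge tau v.
have [e|[j jt [_ e]]] := perturb_chord_cases tau w01; rewrite {1}/psi e.
  apply: le_trans (mono _ _ gu gv).
  by apply: (convex_on_unitP phi0).1.
apply: le_trans (mono _ _ (guj j jt) (gvj j jt)).
by rewrite le_eqVlt; apply/orP; left; apply/eqP; rewrite /chord; ring.
Qed.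

Lemma perturb_chord_dist tau t r : 0 <= t <= 1 -> 0 <= r ->
  (forall j, chord_bump j t <= r) ->
  `|perturb phi0 chord_bump tau t - phi0 t| <= r.
Proof.
move=> t01 r0 br.
have [->|[j jt [-> _]]] := perturb_chord_cases tau t01.
  by rewrite subrr normr0.
by rewrite addrAC subrr add0r ger0_norm ?chord_bump_ge0.
Qed.

Section curvature.
Context (b k1 k2 : R).
Hypothesis phi0_curv : curvature_class a b k1 k2 phi0.
Hypothesis mb : a + L *+ m <= b.
Hypothesis k2_0 : 0 <= k2.

Lemma chord_bump_ge (j : 'I_m) t : knot j < t < knot j.+1 ->
  k1 / 2 * ((t - knot j) * (knot j.+1 - t)) <= chord_bump j t.
Proof.
move=> /andP[jt tj].
have ak : a <= knot j by rewrite -[leLHS]addr0 /knot lerD2l mulrn_wge0// ltW.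
have kb : knot j.+1 <= b by apply: le_trans mb; apply: knot_le; exact: ltn_ord.
have /andP[h _] := chord_defect_bounds phi0_curv ak jt tj kb.
by apply: le_trans h _; rewrite /chord_bump le_max lexx orbT.
Qed.

Lemma chord_bump_le (j : 'I_m) t : 0 <= t <= 1 ->
  chord_bump j t <= k2 / 8 * L ^+ 2.
Proof.
move=> t01; have r0 : 0 <= k2 / 8 * L ^+ 2 by rewrite mulr_ge0 ?sqr_ge0// divr_ge0.
have [/eqP->//|/(chord_bump_support t01)/andP[jt tj]] := boolP (chord_bump j t == 0).
have ak : a <= knot j by rewrite -[leLHS]addr0 /knot lerD2l mulrn_wge0// ltW.
have kb : knot j.+1 <= b by apply: le_trans mb; apply: knot_le; exact: ltn_ord.
have /andP[_ h] := chord_defect_bounds phi0_curv ak jt tj kb.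
rewrite /chord_bump ge_max r0/=; apply: le_trans h _.
have -> : k2 / 8 * L ^+ 2 = k2 / 2 * (L ^+ 2 / 4) by field.
apply: ler_wpM2l; first by rewrite divr_ge0.
have -> : knot j.+1 - t = L - (t - knot j) by rewrite /knot mulrS; ring.
have := sqr_ge0 (t - knot j - L / 2); lra.
Qed.

End curvature.

End chord_family.

Lemma in_local_nbhd (R : realType) (n : nat) (c1 sigma k2 r : R)
    (phi0 phi : R -> R) :
  (k2 * c1 ^+ 2 / 32) `^ (1 / 5) * (sigma ^+ 2 / n%:R) `^ (2 / 5) = r ->
  convex_on_unit phi ->
  (forall t, 0 <= t <= 1 -> `|phi t - phi0 t| <= r) ->
  local_nbhd n c1 sigma k2 phi0 phi.
Proof.
move=> rE cphi dist; split => //; rewrite rE.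
apply: ge_ereal_sup => _ [t /= t01 <-]; rewrite lee_fin; apply: dist.
by move: t01; rewrite in_itv.
Qed.

(** * Counting design points *)

Section design.
Context (R : realType) (n : nat) (c1 c2 : R) (x : 'I_n -> R).
Hypothesis x_quasi_uniform : quasi_uniform_design c1 c2 x.

Lemma design_spacing (i j : 'I_n) : (i <= j)%N ->
  c1 * (j - i)%:R <= n%:R * (x j - x i) <= c2 * (j - i)%:R.
Proof.
have [_ _ step] := x_quasi_uniform.
move=> /subnKC; move: (j - i)%N => k; elim: k j => [|k IH] j jE.
  have -> : j = i by apply: val_inj; rewrite /= -jE addn0.
  by rewrite subrr !mulr0 lexx.
have ltn : (i + k < n)%N by apply: ltn_trans (ltn_ord j); rewrite -jE addnS.
have /andP[l1 u1] := IH (Ordinal ltn) erefl.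
have /andP[l2 u2] : c1 <= n%:R * (x j - x (Ordinal ltn)) <= c2.
  by apply: step; rewrite /= -jE addnS.
rewrite -natr1 (mulrDr c1) (mulrDr c2) !mulr1.
have -> : n%:R * (x j - x i) = n%:R * (x (Ordinal ltn) - x i)
  + n%:R * (x j - x (Ordinal ltn)) by ring.
by apply/andP; split; apply: lerD.
Qed.

(** The indices concerned lie between the smallest and the largest of them, whose
distance the minimal spacing bounds. *)
Lemma design_count_le (u L : R) : 0 < c1 -> 0 <= L ->
  #|[set i | u < x i < u + L]%SET|%:R <= n%:R * L / c1 + 1.
Proof.
move=> c10 L0; set A := [set i | _]%SET.
have rhs0 : 0 <= n%:R * L / c1 by rewrite divr_ge0 ?mulr_ge0// ltW.
have [->|[k kA]] := set_0Vmem A; first by rewrite cards0; lra.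
pose i0 := [arg min_(i < k in A) (i : nat)]; pose i1 := [arg max_(i > k in A) (i : nat)].
have [i0A i0min] : i0 \in A /\ forall j, j \in A -> (i0 <= j)%N.
  by rewrite /i0; case: arg_minnP => // i iA imin; split.
have [i1A i1max] : i1 \in A /\ forall j, j \in A -> (j <= i1)%N.
  by rewrite /i1; case: arg_maxnP => // i iA imax; split.
have cardA : (#|A| <= (i1 - i0).+1)%N.
  rewrite cardE -(size_map (@nat_of_ord n)) -(size_iota i0 (i1 - i0).+1).
  apply: uniq_leq_size; first by rewrite map_inj_uniq ?enum_uniq//; exact: ord_inj.
  move=> y /mapP[i]; rewrite mem_enum => iA ->.
  by rewrite mem_iota i0min//= addnS ltnS subnKC ?i1max// i0min.
have /andP[h _] := design_spacing (i0min _ i1A).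
have : x i1 - x i0 <= L.
  by move: i0A i1A; rewrite !inE => /andP[? ?] /andP[? ?]; lra.
move=> /(ler_wpM2l (ler0n R n)) h2.
apply: (@le_trans _ _ ((i1 - i0)%:R + 1)); first by rewrite natr1 ler_nat.
by rewrite lerD2r ler_pdivlMr// mulrC; lra.
Qed.

Section covering.
Context (a b : R).
Hypothesis x_covers : design_covers c2 a b x.
Hypothesis n0 : (0 < n)%N.

Let nR0 : 0 < n%:R :> R. Proof. by rewrite ltr0n. Qed.

(** The candidate is the successor of the last design point that is at most w; the
covering hypothesis handles the two ends of the design. *)
Lemma design_point_in (w : R) : a <= w -> w + c2 / n%:R < b ->
  exists i, w < x i <= w + c2 / n%:R.
Proof.
move=> aw wb; have [_ mono step] := x_quasi_uniform.
have gap (p q : R) : n%:R * (q - p) <= c2 -> q <= p + c2 / n%:R.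
  by move=> h; rewrite -lerBlDl ler_pdivlMr// mulrC.
have [w0|w0] := ltP w (x (Ordinal n0)).
  exists (Ordinal n0); rewrite w0/=.
  have /gap h := (x_covers (Ordinal n0)).1 erefl; lra.
pose k := [arg max_(i > Ordinal n0 | x i <= w) (i : nat)].
have [kw kmax] : x k <= w /\ forall j : 'I_n, x j <= w -> (j <= k)%N.
  by rewrite /k; case: arg_maxnP => // i iw imax; split.
have [kn|kn] := eqVneq k.+1 n.
  have /gap h := (x_covers k).2 kn; lra.
have kn' : (k.+1 < n)%N by rewrite ltn_neqAle kn ltn_ord.
exists (Ordinal kn'); apply/andP; split.
  by rewrite ltNge; apply/negP => /kmax /=; rewrite ltnn.
have /andP[_ /gap h] := step k (Ordinal kn') erefl; lra.
Qed.

(** Cut [u, v] into M half-open cells of length c2 / n: each holds a design point,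
and distinct cells hold distinct points. *)
Lemma design_count_ge (u v : R) (M : nat) : 0 < c2 ->
  a <= u -> v < b -> M%:R * (c2 / n%:R) <= v - u ->
  (M <= #|[set i | (u <= x i <= v)%R]%SET|)%N.
Proof.
move=> c20 au vb Mg; set g := c2 / n%:R in Mg *.
have g0 : 0 < g by rewrite divr_gt0.
have ex (k : 'I_M) : exists i, u + k%:R * g < x i <= u + k%:R * g + g.
  have kM : k%:R * g + g <= M%:R * g.
    by rewrite -[X in _ + X]mul1r -mulrDl ler_pM2r// natr1 ler_nat.
  apply: design_point_in; last by rewrite -/g; lra.
  have : 0 <= k%:R * g by rewrite mulr_ge0// ltW.
  lra.
have [f fP] := choice ex.
have finj : injective f.
  have lt_of (k l : 'I_M) : (k < l)%N -> f k <> f l.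
    move=> kl e; have /andP[_ h1] := fP k; have /andP[h2 _] := fP l.
    have : k%:R * g + g <= l%:R * g.
      by rewrite -[X in _ + X]mul1r -mulrDl ler_pM2r// natr1 ler_nat.
    by rewrite -e in h2; lra.
  move=> k l e; apply: val_inj; case: (ltngtP (val k) (val l)) => // /lt_of.
    by rewrite e.
  by rewrite e.
rewrite -[leqLHS]card_ord -(card_imset _ finj); apply: subset_leq_card.
apply/fintype.subsetP => _ /imsetP[k _ ->]; rewrite inE.
have /andP[h1 h2] := fP k.
have kg : 0 <= k%:R * g by rewrite mulr_ge0// ltW.
have kM : k%:R * g + g <= M%:R * g.
  by rewrite -[X in _ + X]mul1r -mulrDl ler_pM2r// natr1 ler_nat.
by apply/andP; split; lra.
Qed.

(** Without coverage the design could be much shorter than [a, b]. *)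
Lemma design_interval_length : 0 <= c2 -> (1 < n)%N -> b - a <= 2 * c2.
Proof.
move=> c20 n1; have n1' : (n.-1 < n)%N by rewrite ltn_predL.
have h0 := (x_covers (Ordinal n0)).1 erefl.
have h1 := (x_covers (Ordinal n1')).2 (prednK n0).
have /andP[_ h2] := design_spacing (leq0n (Ordinal n1') : (Ordinal n0 <= Ordinal n1')%N).
rewrite /= subn0 in h2.
have nE : n%:R = n.-1%:R + 1 :> R by rewrite natr1 prednK.
have n1R : 1 <= n.-1%:R :> R by rewrite ler1n -subn1 subn_gt0.
rewrite -(ler_pM2l nR0); nra.
Qed.

End covering.

Lemma design_constants_le : (1 < n)%N -> c1 <= c2.
Proof.
move=> n1; have n0 : (0 < n)%N by exact: ltnW.
have [_ _ step] := x_quasi_uniform.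
have /andP[h1 h2] := step (Ordinal n0) (Ordinal n1) erefl.
exact: le_trans h1 h2.
Qed.

End design.

(** * The bandwidth *)

Section scale.
Context (R : realType) (n : nat) (c1 c2 sigma k2 : R).
Hypothesis n0 : (0 < n)%N.
Hypothesis c1_0 : 0 < c1.
Hypothesis c2_0 : 0 < c2.
Hypothesis sigma0 : 0 < sigma.
Hypothesis k2_0 : 0 < k2.

Let nR0 : 0 < n%:R :> R. Proof. by rewrite ltr0n. Qed.

(** The scale at which a chord over an interval of that length has a total squared
height, over the design points, of the order of sigma ^ 2. *)
Definition bandwidth : R := (c1 * sigma ^+ 2 / (k2 ^+ 2 * n%:R)) `^ (1 / 5).

Lemma powR_root_exp (y : R) (p : R) (k l : nat) : 0 <= y ->
  p * k%:R = l%:R -> (y `^ p) ^+ k = y ^+ l.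
Proof.
by move=> y0 pk; rewrite -powR_mulrn ?powR_ge0// -powRrM pk powR_mulrn.
Qed.

Let base0 : 0 < c1 * sigma ^+ 2 / (k2 ^+ 2 * n%:R).
Proof. by rewrite divr_gt0// mulr_gt0// exprn_gt0. Qed.

Lemma bandwidth_gt0 : 0 < bandwidth.
Proof. exact: powR_gt0. Qed.

Lemma bandwidth_exp5 : bandwidth ^+ 5 = c1 * sigma ^+ 2 / (k2 ^+ 2 * n%:R).
Proof.
rewrite /bandwidth (@powR_root_exp _ _ 5 1) ?expr1// ?(ltW base0)//; lra.
Qed.

Lemma radius_bandwidth :
  (k2 * c1 ^+ 2 / 32) `^ (1 / 5) * (sigma ^+ 2 / n%:R) `^ (2 / 5) =
  k2 * bandwidth ^+ 2 / 2.
Proof.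
apply/eqP; rewrite -(@eqrXn2 _ 5)//; last 2 first.
- by rewrite mulr_ge0 ?powR_ge0.
- by rewrite divr_ge0// mulr_ge0 ?sqr_ge0// ltW.
apply/eqP; rewrite exprMn (@powR_root_exp _ _ 5 1); first last.
- lra.
- by rewrite divr_ge0// mulr_ge0 ?sqr_ge0// ltW.
rewrite (@powR_root_exp _ _ 5 2); first last.
- lra.
- by rewrite divr_ge0 ?sqr_ge0.
rewrite (_ : (k2 * bandwidth ^+ 2 / 2) ^+ 5 = k2 ^+ 5 / 32 * (bandwidth ^+ 5) ^+ 2); last by field.
rewrite bandwidth_exp5.
by field; rewrite !gt_eqF.
Qed.

Lemma rate_bandwidth :
  (Num.sqrt c1 / k2) `^ (8 / 5) * (sigma ^+ 2 / n%:R) `^ (4 / 5) =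
  bandwidth ^+ 4.
Proof.
have q0 : 0 <= Num.sqrt c1 / k2 by rewrite divr_ge0 ?sqrtr_ge0// ltW.
have s0 : 0 <= sigma ^+ 2 / n%:R by rewrite divr_ge0 ?sqr_ge0.
have -> : (Num.sqrt c1 / k2) `^ (8 / 5) = ((Num.sqrt c1 / k2) ^+ 2) `^ (4 / 5).
  by rewrite -powR_mulrn// -(powRrM _ 2%:R (4 / 5)); congr (_ `^ _); field.
have -> : bandwidth ^+ 4 =
    (c1 * sigma ^+ 2 / (k2 ^+ 2 * n%:R)) `^ (4 / 5).
  rewrite /bandwidth -powR_mulrn ?powR_ge0// -(powRrM _ (1 / 5) 4%:R).
  by congr (_ `^ _); field.
rewrite -(powRM (4 / 5) (sqr_ge0 _) s0); congr (_ `^ _).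
rewrite expr_div_n sqr_sqrtr ?ltW//.
by field; rewrite !gt_eqF.
Qed.

Lemma bandwidth_spacing :
  (2 * c2) `^ (5 / 2) * k2 / (sigma * Num.sqrt c1) <= n%:R ^+ 2 ->
  2 * c2 <= n%:R * bandwidth.
Proof.
move=> h; rewrite -(@ler_pXn2r _ 5) ?nnegrE//; last 2 first.
- by rewrite mulr_ge0// ltW.
- by rewrite mulr_ge0// ltW// bandwidth_gt0.
rewrite [leRHS]exprMn bandwidth_exp5.
have s0 : 0 < Num.sqrt c1 by rewrite sqrtr_gt0.
have den0 : 0 < sigma * Num.sqrt c1 by rewrite mulr_gt0.
move: h; rewrite ler_pdivrMr// => h.
have l0 : 0 <= (2 * c2) `^ (5 / 2) * k2 by rewrite mulr_ge0 ?powR_ge0// ltW.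
have h2 := lerXn2r 2 (l0 : _ \is Num.nneg) (le_trans l0 h : _ \is Num.nneg) h.
have e2 : ((2 * c2) `^ (5 / 2)) ^+ 2 = (2 * c2) ^+ 5.
  by apply: powR_root_exp; [rewrite mulr_ge0// ltW|field].
have e3 : (n%:R ^+ 2 * (sigma * Num.sqrt c1)) ^+ 2 =
    (n%:R ^+ 2) ^+ 2 * (sigma ^+ 2 * c1).
  by rewrite !exprMn (sqr_sqrtr (ltW c1_0)).
rewrite e3 exprMn e2 in h2.
rewrite (_ : n%:R ^+ 5 * (c1 * sigma ^+ 2 / (k2 ^+ 2 * n%:R)) =
  (n%:R ^+ 2) ^+ 2 * (sigma ^+ 2 * c1) / k2 ^+ 2); last first.
  by field; rewrite !gt_eqF.
by rewrite ler_pdivlMr ?exprn_gt0.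
Qed.

End scale.

Lemma truncn_half (R : realType) (y : R) : 1 <= y -> y / 2 <= (Num.truncn y)%:R.
Proof.
move=> y1; have y0 : 0 <= y by lra.
have := truncnS_gt y; rewrite -natr1.
have : 1 <= (Num.truncn y)%:R :> R by rewrite ler1n truncn_gt0.
lra.
Qed.

(** * The local minimax lower bound *)

Section local_minimax_lower_bound.
Context (d : measure_display) (T : measurableType d)
    (R : realType) (P : probability T R) (n : nat) (c1 c2 sigma : R)
    (a b k1 k2 : R) (x : 'I_n -> R) (xi : 'I_n -> {RV P >-> R}) (phi0 : R -> R).
Hypothesis hn : (2 <= n)%N.
Hypothesis hc1 : 0 < c1.
Hypothesis hc2 : 0 < c2.
Hypothesis hsigma : 0 < sigma.
Hypothesis ha : 0 <= a.
Hypothesis hb : b <= 1.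
Hypothesis hk1 : 0 < k1.
Hypothesis hk : k1 < k2.
Hypothesis hx : quasi_uniform_design c1 c2 x.
Hypothesis hcover : design_covers c2 a b x.
Hypothesis hxi : gaussian_noise sigma xi.
Hypothesis hphi0 : curvature_class a b k1 k2 phi0.

Let n0 : (0 < n)%N. Proof. exact: ltnW. Qed.
Let nR0 : 0 < n%:R :> R. Proof. by rewrite ltr0n. Qed.
Let x01 i : 0 <= x i <= 1. Proof. by have [] := hx. Qed.
Let phi0_convex : convex_on_unit phi0. Proof. exact: hphi0.1. Qed.
Let k2_0 : 0 < k2. Proof. exact: lt_trans hk1 hk. Qed.

Local Notation rho := (bandwidth n c1 sigma k2).

Lemma local_minimax_risk_ge_bumps m (bump : 'I_m -> R -> R) (v : R) :
  (forall j, \sum_i bump j (x i) ^+ 2 <= sigma ^+ 2) ->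
  (forall i j k, j != k -> bump j (x i) = 0 \/ bump k (x i) = 0) ->
  (forall tau, local_nbhd n c1 sigma k2 phi0 (perturb phi0 bump tau)) ->
  v <= (8 * n%:R)^-1 * \sum_j \sum_i bump j (x i) ^+ 2 ->
  (v%:E <= local_minimax_risk x xi c1 sigma k2 phi0)%E.
Proof.
move=> bsigma disj nbhd vle.
apply: le_ereal_inf_tmp => _ [phihat ephi <-].
have vleE : (v%:E <= ((8 * n%:R)^-1 * \sum_j \sum_i bump j (x i) ^+ 2)%:E)%E.
  by rewrite lee_fin.
apply: (le_trans vleE).
apply: (assouad (lt0r_neq0 hsigma) hxi n0 x01 (phi0 := phi0) bsigma disj ephi).
move=> tau; apply: ereal_sup_ubound; exists (perturb phi0 bump tau) => //.
Qed.

Lemma rho_exp5 : k2 ^+ 2 * rho ^+ 5 * n%:R = c1 * sigma ^+ 2.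
Proof.
rewrite (bandwidth_exp5 n0 hc1 hsigma k2_0); field.
by rewrite !gt_eqF.
Qed.

Let rho0 : 0 < rho. Proof. exact: bandwidth_gt0. Qed.

Let k12 : k1 ^+ 2 <= k2 ^+ 2.
Proof. by rewrite ler_pXn2r ?nnegrE ?(ltW hk) ?(ltW hk1) ?(ltW k2_0). Qed.

(** A single bump, constant and equal to min (r, sigma / sqrt n) with r the radius of
the neighbourhood: it satisfies the hypothesis of [assouad] by the choice of
sigma / sqrt n.  The value r is compared with the claim through
b - a <= 2 c2, the value sigma / sqrt n through b - a <= 2 rho. *)
Lemma local_minimax_risk_ge_short : b - a <= 2 * rho ->
  ((k1 ^+ 2 / (4096 * c2) * (b - a) * rho ^+ 4)%:E
   <= local_minimax_risk x xi c1 sigma k2 phi0)%E.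
Proof.
move=> short.
pose r := k2 * rho ^+ 2 / 2; pose s := sigma / Num.sqrt n%:R.
have r0 : 0 <= r by rewrite divr_ge0// mulr_ge0 ?sqr_ge0// ltW.
have s0 : 0 <= s by rewrite divr_ge0 ?sqrtr_ge0// ltW.
have s2 : s ^+ 2 * n%:R = sigma ^+ 2.
  by rewrite expr_div_n sqr_sqrtr ?ltW// divfK// gt_eqF.
pose delta := Num.min r s.
have delta0 : 0 <= delta by rewrite le_min r0.
apply: (@local_minimax_risk_ge_bumps 1 (fun _ _ => delta)).
- move=> _; rewrite sumr_const card_ord -mulr_natr -s2 ler_pM2r//.
  by rewrite ler_pXn2r ?nnegrE// ge_min lexx orbT.
- by move=> i j k; rewrite !ord1 eqxx.
- move=> tau; apply: (in_local_nbhd (radius_bandwidth n0 hc1 hsigma k2_0)).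
    apply/convex_on_unitP => u v t u01 v01 t01; rewrite /perturb.
    have := (convex_on_unitP phi0).1 phi0_convex u v t u01 v01 t01.
    set q := \sum_(j in tau) delta; lra.
  move=> t _; rewrite /perturb addrAC subrr add0r ger0_norm ?sumr_ge0//.
  apply: (@le_trans _ _ delta); last by rewrite ge_min lexx.
  rewrite sumr_const -mulr_natr ler_piMr// lern1.
  by rewrite (leq_trans (max_card _))// card_ord.
rewrite big_ord_recl big_ord0 addr0 sumr_const card_ord -(mulr_natr (delta ^+ 2)).
have -> : (8 * n%:R)^-1 * (delta ^+ 2 * n%:R) = delta ^+ 2 / 8.
  by field; rewrite gt_eqF.
have rho4 : 0 < rho ^+ 4 by rewrite exprn_gt0.
have c12 := design_constants_le hx hn.
have -> : k1 ^+ 2 / (4096 * c2) * (b - a) * rho ^+ 4 =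
  k1 ^+ 2 * rho ^+ 4 * (b - a) / c2 / 4096 by field; rewrite gt_eqF.
have kr0 : 0 <= k1 ^+ 2 * rho ^+ 4 by rewrite mulr_ge0 ?sqr_ge0// ltW.
have kr : k1 ^+ 2 * rho ^+ 4 <= k2 ^+ 2 * rho ^+ 4 by rewrite ler_pM2r.
rewrite /delta; case: (leP r s) => _.
- have len := design_interval_length hx hcover n0 (ltW hc2) hn.
  have : k1 ^+ 2 * rho ^+ 4 * (b - a) / c2 <= k1 ^+ 2 * rho ^+ 4 * 2.
    by have := ler_wpM2l kr0 len; rewrite ler_pdivrMr//; lra.
  have -> : r ^+ 2 = k2 ^+ 2 * rho ^+ 4 / 4 by rewrite /r; field.
  lra.
- have : k1 ^+ 2 * rho ^+ 4 * (b - a) / c2 <= 2 * s ^+ 2.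
    rewrite ler_pdivrMr//; apply: (@le_trans _ _ (k2 ^+ 2 * rho ^+ 4 * (2 * rho))).
      by apply: (le_trans (ler_wpM2l kr0 short)); rewrite ler_wpM2r// mulr_ge0// ltW.
    have -> : k2 ^+ 2 * rho ^+ 4 * (2 * rho) = 2 * (k2 ^+ 2 * rho ^+ 5) by ring.
    have -> : k2 ^+ 2 * rho ^+ 5 = c1 * s ^+ 2.
      by apply: (mulIf (lt0r_neq0 nR0)); rewrite rho_exp5 -mulrA s2.
    by have := ler_wpM2r (sqr_ge0 s) c12; lra.
  by have := sqr_ge0 s; lra.
Qed.

(** There are at least (b - a) / (4 rho) chords of length 2 rho.  On the middle half
of its interval each bump is at least 3 / 8 * k1 * rho ^ 2, and that half
contains at least n rho / (2 c2) design points.  The product of these quantities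
is 9 times the claimed bound. *)
Lemma local_minimax_risk_ge_long : 2 * c2 <= n%:R * rho -> 2 * rho <= b - a ->
  ((k1 ^+ 2 / (4096 * c2) * (b - a) * rho ^+ 4)%:E
   <= local_minimax_risk x xi c1 sigma k2 phi0)%E.
Proof.
move=> spacing long.
pose L := 2 * rho; pose r := k2 * rho ^+ 2 / 2.
have L0 : 0 < L by rewrite mulr_gt0.
have rho_gt0 : 0 < rho := rho0.
have c2_gt0 : 0 < c2 := hc2.
have ab0 : 0 <= b - a by lra.
pose m := Num.truncn ((b - a) / L).
have m_half : (b - a) / L / 2 <= m%:R by apply: truncn_half; rewrite ler_pdivlMr// mul1r.
have mb : a + L *+ m <= b.
  rewrite -lerBrDl -mulr_natl -ler_pdivlMr// truncn_le.
  by rewrite divr_ge0// ltW.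
have m1 : a + L *+ m <= 1 by exact: le_trans mb hb.
pose bump := chord_bump phi0 a L (m := m).
have r0 : 0 <= r by rewrite divr_ge0// mulr_ge0 ?sqr_ge0// ltW.
have bump_le j t : 0 <= t <= 1 -> bump j t <= r.
  move=> t01; apply: (le_trans (chord_bump_le phi0_convex L0 ha m1 hphi0 mb (ltW k2_0) j t01)).
  by rewrite /r /L; lra.
have c12 := design_constants_le hx hn.
have knotS j : knot a L j.+1 = knot a L j + L by rewrite /knot mulrS; ring.
have kb (j : 'I_m) : knot a L j.+1 <= b.
  by apply: le_trans mb; apply: (knot_le _ L0); exact: ltn_ord.
have ak (j : 'I_m) : a <= knot a L j by rewrite /knot lerDl mulrn_wge0// ltW.
apply: (@local_minimax_risk_ge_bumps m bump).
- move=> j.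
  pose A := [set i | knot a L j < x i < knot a L j + L]%SET.
  have cardA : #|A|%:R <= n%:R * L / c1 + 1 := design_count_le hx _ hc1 (ltW L0).
  rewrite (bigID (mem A))/= [X in _ + X]big1 ?addr0; last first.
    move=> i iA; apply/eqP; rewrite sqrf_eq0; apply: contraNT iA => bi.
    rewrite inE -knotS.
    exact: (chord_bump_support phi0_convex L0 ha m1 (x01 i) bi).
  apply: (@le_trans _ _ (\sum_(i in A) r ^+ 2)).
    apply: ler_sum => i _; rewrite ler_pXn2r ?nnegrE ?chord_bump_ge0//.
    exact: bump_le.
  rewrite sumr_const -(mulr_natr _ #|A|).
  apply: le_trans (ler_wpM2l (sqr_ge0 r) cardA) _.
  have -> : r ^+ 2 = k2 ^+ 2 * rho ^+ 4 / 4 by rewrite /r; field.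
  (* The additional point in [design_count_le] is absorbed by n rho >= 2 c1. *)
  have one_le : 1 <= n%:R * rho / c1 / 2.
    by rewrite !ler_pdivlMr// mul1r; lra.
  have kr0 : 0 <= k2 ^+ 2 * rho ^+ 4 by rewrite mulr_ge0 ?exprn_ge0// ltW.
  have -> : sigma ^+ 2 = k2 ^+ 2 * rho ^+ 4 * (n%:R * rho / c1).
    apply: (mulfI (lt0r_neq0 hc1)); rewrite -rho_exp5; field.
    by rewrite gt_eqF.
  rewrite [leLHS](_ : _ = k2 ^+ 2 * rho ^+ 4 * ((n%:R * L / c1 + 1) / 4)); last by ring.
  by apply: ler_wpM2l => //; rewrite /L; lra.
- by move=> i j k jk; exact: (chord_bump_disjoint phi0_convex L0 ha m1 (x01 i) jk).
- move=> tau; apply: (in_local_nbhd (radius_bandwidth n0 hc1 hsigma k2_0)).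
    exact: perturb_chord_convex.
  move=> t t01; apply: (perturb_chord_dist phi0_convex L0 ha m1) => //.
  by move=> j; exact: bump_le.
pose M := Num.truncn (rho / (c2 / n%:R)).
have g0 : 0 < c2 / n%:R by rewrite divr_gt0.
have M_half : rho / (c2 / n%:R) / 2 <= M%:R.
  by apply: truncn_half; rewrite ler_pdivlMr// mul1r ler_pdivrMr//; lra.
have per_bump j : (3 / 8 * k1 * rho ^+ 2) ^+ 2 * M%:R <= \sum_i bump j (x i) ^+ 2.
  pose A := [set i | (knot a L j + rho / 2 <= x i <= knot a L j + 3 / 2 * rho)%R]%SET.
  have cardA : (M <= #|A|)%N.
    apply: (design_count_ge hx hcover n0 hc2).
    - by have := ak j; lra.
    - by have := kb j; rewrite knotS /L; lra.
    - have -> : knot a L j + 3 / 2 * rho - (knot a L j + rho / 2) = rho by field.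
      by rewrite -ler_pdivlMr// truncn_le divr_ge0// ltW.
  rewrite (bigID (mem A))/=.
  apply: (@le_trans _ _ (\sum_(i in A) bump j (x i) ^+ 2)); last first.
    by rewrite lerDl sumr_ge0// => i _; exact: sqr_ge0.
  apply: (@le_trans _ _ (\sum_(i in A) (3 / 8 * k1 * rho ^+ 2) ^+ 2)).
    by rewrite sumr_const -(mulr_natr _ #|A|) ler_wpM2l ?sqr_ge0// ler_nat.
  apply: ler_sum => i; rewrite inE => /andP[il iu].
  have q0 : 0 <= 3 / 8 * k1 * rho ^+ 2.
    by rewrite mulr_ge0 ?sqr_ge0// mulr_ge0// ltW.
  rewrite ler_pXn2r ?nnegrE ?chord_bump_ge0//.
  have inside : knot a L j < x i < knot a L j.+1.
    by rewrite knotS /L; apply/andP; split; lra.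
  apply: le_trans (chord_bump_ge L0 hphi0 mb inside).
  rewrite knotS (_ : 3 / 8 * k1 * rho ^+ 2 = k1 / 2 * (3 / 4 * rho ^+ 2)); last by field.
  apply: ler_wpM2l; first by rewrite divr_ge0// ltW.
  rewrite /L.
  have : 0 <= (x i - knot a L j - rho / 2) * (knot a L j + 3 / 2 * rho - x i).
    by rewrite mulr_ge0//; lra.
  lra.
apply: (@le_trans _ _ ((8 * n%:R)^-1 * \sum_(j < m) ((3 / 8 * k1 * rho ^+ 2) ^+ 2 * M%:R))); last first.
  by rewrite ler_wpM2l ?invr_ge0 ?mulr_ge0 ?(ltW nR0)// ler_sum.
rewrite sumr_const card_ord -(mulr_natr (_ ^+ 2 * M%:R)).
have q0 : 0 <= (3 / 8 * k1 * rho ^+ 2) ^+ 2 by exact: sqr_ge0.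
apply: (@le_trans _ _ ((8 * n%:R)^-1 * ((3 / 8 * k1 * rho ^+ 2) ^+ 2 *
    (rho / (c2 / n%:R) / 2) * ((b - a) / L / 2)))); last first.
  rewrite ler_wpM2l ?invr_ge0 ?mulr_ge0 ?(ltW nR0)//.
  apply: ler_pM => //.
  - by rewrite mulr_ge0// divr_ge0// divr_ge0// ltW.
  - by rewrite divr_ge0// divr_ge0// ltW.
  - exact: ler_wpM2l.
have -> : (8 * n%:R)^-1 * ((3 / 8 * k1 * rho ^+ 2) ^+ 2 *
    (rho / (c2 / n%:R) / 2) * ((b - a) / L / 2)) =
  9 * (k1 ^+ 2 / (4096 * c2) * (b - a) * rho ^+ 4).
  rewrite /L; field; by rewrite !gt_eqF.
have target0 : 0 <= k1 ^+ 2 / (4096 * c2) * (b - a) * rho ^+ 4.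
  apply: mulr_ge0; last exact: exprn_ge0 (ltW rho0).
  apply: mulr_ge0 ab0; apply: divr_ge0; first exact: sqr_ge0.
  exact: mulr_ge0 (ler0n _ _) (ltW hc2).
by apply: ler_peMl target0 _; rewrite ler1n.
Qed.

End local_minimax_lower_bound.

Unset Implicit Arguments.

Theorem theorem5p1 (d : measure_display) (T : measurableType d)
    (R : realType) (P : probability T R) (n : nat) (c1 c2 sigma : R)
    (a b k1 k2 : R) (x : 'I_n -> R) (xi : 'I_n -> {RV P >-> R})
    (hn : (2 <= n)%N) (hc1 : 0 < c1) (hc2 : 0 < c2) (hsigma : 0 < sigma)
    (ha : 0 <= a) (hab : a <= b) (hb : b <= 1)
    (hk1 : 0 < k1) (hk : k1 < k2)
    (hx : quasi_uniform_design c1 c2 x)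
    (hcover : design_covers c2 a b x)
    (hxi : gaussian_noise sigma xi)
    (hlarge : (2 * c2) `^ (5 / 2) * k2 / (sigma * Num.sqrt c1) <= n%:R ^+ 2)
    (phi0 : R -> R) (hphi0 : curvature_class a b k1 k2 phi0) :
  ((k1 ^+ 2 / (4096 * c2) * (Num.sqrt c1 / k2) `^ (8 / 5) * (b - a) *
    (sigma ^+ 2 / n%:R) `^ (4 / 5))%:E
   <= local_minimax_risk x xi c1 sigma k2 phi0)%E.
Proof.
have n0 : (0 < n)%N by exact: ltnW.
have k2_0 : 0 < k2 by lra.
have spacing := bandwidth_spacing n0 hc1 hc2 hsigma k2_0 hlarge.
have -> : k1 ^+ 2 / (4096 * c2) * (Num.sqrt c1 / k2) `^ (8 / 5) * (b - a) *
    (sigma ^+ 2 / n%:R) `^ (4 / 5) =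
    k1 ^+ 2 / (4096 * c2) * (b - a) * bandwidth n c1 sigma k2 ^+ 4.
  by rewrite -(rate_bandwidth sigma n0 hc1 k2_0); ring.
have [short|long] := leP (b - a) (2 * bandwidth n c1 sigma k2).
  exact: (local_minimax_risk_ge_short hn hc1 hc2 hsigma hk1 hk hx hcover hxi hphi0 short).
exact: (local_minimax_risk_ge_long hn hc1 hc2 hsigma ha hb hk1 hk hx hcover hxi hphi0
  spacing (ltW long)).
Qed.
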